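(* Let $\xi_0,\xi_1,\xi_2,\ldots$ be independent and identically distributed real random variables, and suppose $\xi_0$ satisfies condition (H): there exist $M>0$ and $q\in(0,1)$ with \[ \sup_{u\in\mathbb{R}}\mathbb{P}(|\xi_0-u|\le 1)\le 1-q\quad\text{and}\quad \mathbb{P}(|\xi_0|>M)\le q/2. \] For $n\ge1$ let $\mathcal{C}_n$ be the $n\times n$ random circulant matrix whose $(i,j)$ entry, for $0\le i,j\le n-1$, is $\xi_{(j-i)\bmod n}$ (so its first row is $(\xi_0,\xi_1,\ldots,\xi_{n-1})$ and each subsequent row is the cyclic right shift of the previous one). Then for any $\varepsilon>0$ and $\rho\in(0,1/4)$, for all large $n$, \[ \mathbb{P}\left(\sigma_{\min}(\mathcal{C}_n)\le \varepsilon n^{-\rho}\right)\le C\left(\frac{\varepsilon^2+\varepsilon}{n^{2\rho}}+\frac{1}{n^{1/2-o(1)}}\right), \] where $C>0$ depends only on the distribution of $\xi_0$.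
   Context: $\sigma_{\min}(A)$ denotes the smallest singular value of a square matrix $A$, i.e. $\min_{\|x\|_2=1}\|Ax\|_2$. The notation $n^{-1/2+o(1)}$ means $n^{-1/2+\delta_n}$ for some sequence $\delta_n\to 0$ as $n\to\infty$. *)

(* Defs.v *)
From HB Require Import structures.
From mathcomp Require Import all_boot all_order all_algebra.
From mathcomp Require Import all_classical all_reals all_analysis.
Set Implicit Arguments. Unset Strict Implicit. Unset Printing Implicit Defensive.
Import Order.TTheory GRing.Theory Num.Theory.
Import numFieldNormedType.Exports.
Local Open Scope classical_set_scope.
Local Open Scope ring_scope.

Definition mutually_independent {R : realType} {d : measure_display}
  {T : measurableType d} (P : probability T R) (X : nat -> T -> R) : Prop :=
  forall (s : seq nat) (A : nat -> set R), uniq s ->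
    (forall i, measurable (A i)) ->
    P (\big[setI/setT]_(i <- s) (X i @^-1` A i)) =
    (\prod_(i <- s) P (X i @^-1` A i))%E.

Definition identically_distributed {R : realType} {d : measure_display}
  {T : measurableType d} (P : probability T R) (X : nat -> T -> R) : Prop :=
  forall (n : nat) (A : set R), measurable A ->
    P (X n @^-1` A) = P (X 0 @^-1` A).

Definition condH {R : realType} {d : measure_display}
  {T : measurableType d} (P : probability T R) (Y : T -> R) : Prop :=
  exists (M q : R), 0 < M /\ 0 < q < 1 /\
    (forall u : R, (P [set w | (`|Y w - u| <= 1)%R] <= (1 - q)%:E)%E) /\
    (P [set w | (M < `|Y w|)%R ] <= (q / 2)%:E)%E.

Definition vnorm2 {R : realType} {n : nat} (x : 'cV[R]_n) : R :=
  Num.sqrt (\sum_(i < n) x i 0 ^+ 2).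

Definition sigma_min {R : realType} {n : nat} (A : 'M[R]_n) : R :=
  inf [set vnorm2 (A *m x) | x in [set x : 'cV[R]_n | vnorm2 x = 1]].

Definition circulant {R : realType} (n : nat) (a : nat -> R) : 'M[R]_n :=
  \matrix_(i < n, j < n) a ((j + n - i) %% n)%N.

(* Main.v *)
(** The singular values of a circulant matrix are the moduli of the discrete
    Fourier transform [S_k = sum_j xi_j e^{2 pi i j k / n}] of its first row, so
    it suffices to bound [sum_k P (|S_k| <= t)] for [t = eps n^-rho].

    A discrete Esseen inequality bounds each small ball probability by an
    average of the characteristic function of [S_k] over a grid of mesh [n^-1/2]
    and radius [1/t].  After symmetrisation its size at frequency [(u, v)] is
    controlled by [sum_j (1 - cos (s r cos (2 pi j k / n - a)))], where [r] is the
    modulus of the frequency.  As long as [s r <= 1] this sum is of order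
    [n (s r)^2].  For larger [r], pass to the increments [j -> j + l] with
    [s r |e^{2 pi i k l / n} - 1|] of order 1: the sum is then of order [n].  Such
    an [l] exists as soon as [n / gcd(n, k)] exceeds [n^{1/4} >> 1/t], and then
    [P (|S_k| <= t) <= C t^2 / n + e^{-cn}].

    There are at most [n^{1/2}] other frequencies.  For them only [t] of order 1 is
    used, which gives [C / n] each, except when [S_k] is real ([n | 2 k], at most two
    frequencies), where it gives [C / n^{1/2}].  In total the probability is at
    most [C (eps^2 n^{-2 rho} + n^{-1/2})], so that [delta = 0] is admissible. *)

Require Import Defs.
From HB Require Import structures.
From mathcomp Require Import all_boot all_order all_algebra.
From mathcomp Require Import all_classical all_reals all_analysis.
From mathcomp Require Import measurable_realfun ring lra.
Import Order.TTheory GRing.Theory Num.Theory.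
Import numFieldNormedType.Exports.
Local Open Scope classical_set_scope.
Local Open Scope ring_scope.

(** * Cosine deficits [1 - cos] of sampled trigonometric waves *)

Section Trigonometry.
Context {R : realType}.
Implicit Types (x y u v b : R) (n j l : nat).

Lemma cosB1_sin x : 1 - cos x = 2 * sin (x / 2) ^+ 2.
Proof.
rewrite sin2cos2; have -> : cos x = cos ((x / 2) *+ 2) by congr cos; lra.
by rewrite cos_mulr2n; lra.
Qed.

Lemma sin_MVT x : 0 < x -> exists2 c : R, 0 < c < x & sin x = cos c * x.
Proof.
move=> x0.
have [|c] := @MVT R sin cos 0 x x0 (fun y _ => is_derive_sin y).
  by apply: continuous_subspaceT => y; exact: continuous_sin.
by rewrite in_itv /= sin0 !subr0 => c0x ->; exists c.
Qed.

Lemma ler_sin_id x : 0 <= x -> sin x <= x.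
Proof.
rewrite le_eqVlt => /predU1P[<-|x0]; first by rewrite sin0.
have [c _ ->] := sin_MVT x x0.
by rewrite ler_piMl ?cos_le1 // ltW.
Qed.

Lemma sqr_sin_le x : sin x ^+ 2 <= x ^+ 2.
Proof.
wlog x0 : x / 0 <= x => [h|].
  by case: (leP 0 x) => [/h//|/ltW x0]; rewrite -sqrrN -sinN -[leRHS]sqrrN h ?oppr_ge0.
have sx := ler_sin_id _ x0.
suff : - x <= sin x by nra.
have [x1|x1] := leP x 1; last by have := sin_geN1 x; lra.
have p2 := pi_ge2 R.
by have : 0 <= sin x by [apply: sin_ge0_pi; lra]; lra.
Qed.

Lemma onemcos_le x : 1 - cos x <= x ^+ 2 / 2.
Proof. by rewrite cosB1_sin; have := sqr_sin_le (x / 2); lra. Qed.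

Lemma onemcos_ge0 x : 0 <= 1 - cos x.
Proof. by rewrite subr_ge0 cos_le1. Qed.

(** By the mean value theorem [sin (x / 2) = cos c * (x / 2)] with [0 < c < 1/2], where
    [cos c >= 3/4]. The resulting constant [2 * (9/16) / 4 = 9/32] is above [1/4]. *)
Lemma onemcos_ge x : x ^+ 2 <= 1 -> x ^+ 2 / 4 <= 1 - cos x.
Proof.
wlog x0 : x / 0 < x => [h|].
  have [x0|x0|->] := ltgtP x 0; [|exact: h|].
    by rewrite -sqrrN -cosN => x1; apply: h; lra.
  by rewrite cos0 expr0n /= mul0r subrr.
move=> x1.
have xle1 : x <= 1 by nra.
have [c /andP[c0 cx] sE] := @sin_MVT (x / 2) ltac:(lra).
have hc : 3 / 4 <= cos c by have := onemcos_le c; nra.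
have hs : 3 / 4 * (x / 2) <= sin (x / 2) by rewrite sE; nra.
by rewrite cosB1_sin; nra.
Qed.

(** Twice the difference of the two sides is [|2 - e^{ix} - e^{iy}|^2]. The deficit behaves like a
    squared length, and the factor 2 is the price of its triangle inequality. *)
Lemma onemcosB_le x y : 1 - cos (x - y) <= 2 * (1 - cos x) + 2 * (1 - cos y).
Proof.
have := cos2Dsin2 x; have := cos2Dsin2 y; rewrite cosB.
have := sqr_ge0 (2 - cos x - cos y); have := sqr_ge0 (sin x + sin y).
by nra.
Qed.

Lemma onemcosD_le x y : 1 - cos (x + y) <= 2 * (1 - cos x) + 2 * (1 - cos y).
Proof. by have := onemcosB_le x (- y); rewrite opprK cosN. Qed.

Lemma sum_periodic_shift n l (f : nat -> R) : (forall j, f (j + n)%N = f j) ->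
  \sum_(j < n) f (j + l)%N = \sum_(j < n) f j.
Proof.
move=> fn; elim: l => [|l <-]; first by under eq_bigr do rewrite addn0.
apply/eqP; rewrite -subr_eq0 -sumrB.
rewrite -(big_mkord xpredT (fun j => f (j + l.+1)%N - f (j + l)%N)).
under eq_bigr do rewrite addnS -addSn.
by rewrite (telescope_sumr (fun j => f (j + l)%N)) // addnC fn add0n subrr.
Qed.

Lemma cosMnDl n b j : cos (n%:R * b) = 1 -> cos ((j + n)%:R * b) = cos (j%:R * b).
Proof.
move=> h; have s0 : sin (n%:R * b) = 0 by apply: cos1sin0; rewrite h normr1.
by rewrite natrD mulrDl cosD h s0 mulr1 mulr0 subr0.
Qed.

Lemma sinMnDl n b j : cos (n%:R * b) = 1 -> sin ((j + n)%:R * b) = sin (j%:R * b).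
Proof.
move=> h; have s0 : sin (n%:R * b) = 0 by apply: cos1sin0; rewrite h normr1.
by rewrite natrD mulrDl sinD h s0 mulr1 mulr0 addr0.
Qed.

Lemma cosMn_eq1 n b j : cos (n%:R * b) = 1 -> cos (n%:R * (j%:R * b)) = 1.
Proof.
move=> h; elim: j => [|j IH]; first by rewrite mul0r mulr0 cos0.
have s0 : sin (n%:R * b) = 0 by apply: cos1sin0; rewrite h normr1.
by rewrite -addn1 natrD mulrDl mul1r mulrDr cosD IH h s0 mulr1 mulr0 subr0.
Qed.

(** A geometric sum of roots of unity. Shifting the index multiplies [A + iB] by [e^{ib}] and, by
    periodicity, leaves it unchanged. *)
Lemma sum_cos_sin_eq0 n b : cos (n%:R * b) = 1 -> cos b != 1 ->
  \sum_(j < n) cos (j%:R * b) = 0 /\ \sum_(j < n) sin (j%:R * b) = 0.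
Proof.
move=> h b1.
set A := \sum_(j < n) _; set B := \sum_(j < n) _.
have hA : A = A * cos b - B * sin b.
  rewrite {1}/A -(@sum_periodic_shift n 1 (fun j => cos (j%:R * b))); last first.
    by move=> j; exact: cosMnDl.
  rewrite /A /B !mulr_suml -sumrB; apply: eq_bigr => j _.
  by rewrite natrD mulrDl mul1r cosD.
have hB : B = B * cos b + A * sin b.
  rewrite {1}/B -(@sum_periodic_shift n 1 (fun j => sin (j%:R * b))); last first.
    by move=> j; exact: sinMnDl.
  rewrite /A /B !mulr_suml -big_split; apply: eq_bigr => j _ /=.
  by rewrite natrD mulrDl mul1r sinD.
(* Real part of [|A + iB|^2 (1 - e^{ib})]. *)
have : (A ^+ 2 + B ^+ 2) * (1 - cos b) = 0.
  have -> : (A ^+ 2 + B ^+ 2) * (1 - cos b) =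
    A * (A - (A * cos b - B * sin b)) + B * (B - (B * cos b + A * sin b)) by ring.
  by rewrite -hA -hB !subrr !mulr0 addr0.
move/eqP; rewrite mulf_eq0 subr_eq0 [1 == _]eq_sym (negbTE b1) orbF.
rewrite paddr_eq0 ?sqr_ge0 // !sqrf_eq0 => /andP[/eqP -> /eqP ->]; done.
Qed.

(** Real part of [(u - iv) e^{itb}]. At an integer [t] it is the coefficient of the variable number
    [t] in [u Re S + v Im S], with [S] the Fourier sum at angle [b]. *)
Definition wave b u v (t : R) : R := u * cos (t * b) + v * sin (t * b).

Lemma wave_sqr_le b u v t : wave b u v t ^+ 2 <= u ^+ 2 + v ^+ 2.
Proof.
rewrite /wave -[leRHS]mulr1 -(cos2Dsin2 (t * b)) -subr_ge0.
set c := cos _; set s := sin _.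
rewrite [leRHS](_ : _ = (u * s - v * c) ^+ 2) ?sqr_ge0 //; ring.
Qed.

(** The square is a constant plus a wave at the doubled angle, and the latter sums to 0 over a full
    period because [e^{2ib}] is a root of unity other than 1. *)
Lemma sum_wave_sqr n b u v : cos (n%:R * b) = 1 -> cos (2 * b) != 1 ->
  \sum_(j < n) wave b u v j%:R ^+ 2 = n%:R * (u ^+ 2 + v ^+ 2) / 2.
Proof.
move=> h b2.
have h2 : cos (n%:R * (2 * b)) = 1 by exact: cosMn_eq1.
have [c0 s0] := sum_cos_sin_eq0 n (2 * b) h2 b2.
transitivity (\sum_(j < n) ((u ^+ 2 + v ^+ 2) / 2 +
  ((u ^+ 2 - v ^+ 2) / 2 * cos (j%:R * (2 * b)) + u * v * sin (j%:R * (2 * b))))).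
  apply: eq_bigr => j _; have -> : j%:R * (2 * b) = (j%:R * b) *+ 2 by rewrite -mulr_natl; ring.
  rewrite cos_mulr2n sin_mulr2n /wave; have := sin2cos2 (j%:R * b).
  set c := cos _; set s := sin _ => hs.
  have -> : (u * c + v * s) ^+ 2 = u ^+ 2 * c ^+ 2 + 2 * u * v * c * s + v ^+ 2 * s ^+ 2 by ring.
  by rewrite hs -(mulr_natl (c ^+ 2)) -(mulr_natl (c * s)); field.
by rewrite !big_split /= -!mulr_sumr c0 s0 !mulr0 !addr0 sumr_const card_ord -mulr_natl; ring.
Qed.

Lemma sum_onemcos_wave_small n b u v : cos (n%:R * b) = 1 -> cos (2 * b) != 1 ->
  u ^+ 2 + v ^+ 2 <= 1 ->
  n%:R * (u ^+ 2 + v ^+ 2) / 8 <= \sum_(j < n) (1 - cos (wave b u v j%:R)).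
Proof.
move=> h b2 uv.
apply: (@le_trans _ _ (\sum_(j < n) wave b u v j%:R ^+ 2 / 4)).
  by rewrite -mulr_suml sum_wave_sqr //; lra.
apply: ler_sum => j _; apply: onemcos_ge.
exact: le_trans (wave_sqr_le _ _ _ _) uv.
Qed.

(** Here [e^{ib}] is 1 or -1, so the sines vanish and each sample is [u] up to sign. Only [u] can
    appear in the bound. *)
Lemma sum_onemcos_wave_real n b u v : cos (2 * b) = 1 -> u ^+ 2 <= 1 ->
  n%:R * u ^+ 2 / 4 <= \sum_(j < n) (1 - cos (wave b u v j%:R)).
Proof.
move=> h u1.
have sb : sin b = 0.
  move: h; rewrite mulr_natl cos_mulr2n cos2sin2 => h.
  by apply/eqP; rewrite -sqrf_eq0; apply/eqP; move: h; rewrite -(mulr_natl (1 - _)); lra.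
have sj j : sin (j%:R * b) = 0.
  elim: j => [|j IH]; first by rewrite mul0r sin0.
  by rewrite -addn1 natrD mulrDl mul1r sinD IH sb mulr0 mul0r addr0.
apply: (@le_trans _ _ (\sum_(j < n) u ^+ 2 / 4)).
  by rewrite sumr_const card_ord -[(_ / _) *+ _]mulr_natl mulrA.
apply: ler_sum => j _.
have : (wave b u v j%:R) ^+ 2 = u ^+ 2.
  rewrite /wave sj mulr0 addr0 exprMn cos2sin2 sj expr0n /=; ring.
by move=> <-; apply: onemcos_ge; rewrite /wave sj mulr0 addr0 exprMn cos2sin2 sj expr0n /=; lra.
Qed.

(** The cosines sum to 0, so one of them is nonpositive and the squared chord [2 - 2 cos (lb)]
    reaches 2. The first [l] that brings [r] times it above [1/4] does not overshoot: one step costs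
    at most [2 * (1/4) + 2 * (1/4) = 1]. *)
Lemma exists_chord n b r : (0 < n)%N -> cos (n%:R * b) = 1 -> cos b != 1 ->
  1 <= r -> r * (2 - 2 * cos b) <= 1 / 4 ->
  exists l, 1 / 4 < r * (2 - 2 * cos (l%:R * b)) <= 1.
Proof.
move=> n0 h b1 r1 rb.
have [i hi] : exists i, cos (i%:R * b) <= 0.
  apply/not_existsP => hpos.
  have [+ _] := sum_cos_sin_eq0 n b h b1.
  apply/eqP; rewrite gt_eqF //; case: n n0 h => // n _ _.
  rewrite big_ord_recl /= mul0r cos0 ltr_pwDl // sumr_ge0 // => j _.
  by have /negP := hpos (lift ord0 j); rewrite -ltNge => /ltW.
have ex : exists i, 1 / 4 < r * (2 - 2 * cos (i%:R * b)) by exists i; nra.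
case: (ex_minnP ex) => -[|l] hl min.
  by move: hl; rewrite mul0r cos0; lra.
exists l.+1; rewrite hl /=.
have hl' : r * (2 - 2 * cos (l%:R * b)) <= 1 / 4.
  by rewrite leNgt; apply/negP => /min; rewrite ltnn.
have := ler_wpM2l (le_trans ler01 r1) (onemcosD_le (l%:R * b) b).
have E : l.+1%:R * b = l%:R * b + b by rewrite -[l.+1%:R](natr1 l) mulrDl mul1r.
by rewrite E; move: hl' rb; clear; nra.
Qed.

(* The increments of a wave along a shift [l] form again a wave, of amplitude
   [|e^{ilb} - 1|] times the original one; choosing [l] so that this amplitude is
   of order 1 reduces a large frequency to a bounded one. *)
Lemma sum_onemcos_wave_large n b u v (j0 : nat) : (0 < n)%N ->
  cos (n%:R * b) = 1 -> cos (2 * b) != 1 ->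
  1 <= u ^+ 2 + v ^+ 2 -> cos (j0%:R * b) != 1 ->
  (u ^+ 2 + v ^+ 2) * (2 - 2 * cos (j0%:R * b)) <= 1 / 4 ->
  n%:R / 128 <= \sum_(j < n) (1 - cos (wave b u v j%:R)).
Proof.
move=> n0 h b2 uv1 j01 uvj0.
have [i] := @exists_chord n (j0%:R * b) _ n0 (cosMn_eq1 _ _ _ h) j01 uv1 uvj0.
have -> : i%:R * (j0%:R * b) = (i * j0)%:R * b by rewrite natrM mulrA.
set l := (i * j0)%N => /andP[gl ll].
set c := cos (l%:R * b) in gl ll; set s := sin (l%:R * b).
(* Real form of [u' - iv' = (u - iv)(e^{ilb} - 1)]. *)
pose u' := u * (c - 1) + v * s; pose v' := - u * s + v * (c - 1).
have cs : c ^+ 2 + s ^+ 2 = 1 := cos2Dsin2 _.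
have uv' : u' ^+ 2 + v' ^+ 2 = (u ^+ 2 + v ^+ 2) * (2 - 2 * c).
  rewrite /u' /v'.
  transitivity ((u ^+ 2 + v ^+ 2) * (c ^+ 2 + s ^+ 2 + 1 - 2 * c)); first by ring.
  by rewrite cs; ring.
have wE j : wave b u' v' j%:R = wave b u v (j + l)%N%:R - wave b u v j%:R.
  have E : (j + l)%:R * b = j%:R * b + l%:R * b by rewrite natrD mulrDl.
  by rewrite /wave E cosD sinD -/c -/s /u' /v'; ring.
(* The squared amplitude of the increments lies between [1/4] and 1. Their total deficit is at most
   four times that of the wave, which turns [n/32] into [n/128]. *)
have hlow : n%:R / 32 <= \sum_(j < n) (1 - cos (wave b u' v' j%:R)).
  apply: le_trans (sum_onemcos_wave_small n b u' v' h b2 _); rewrite uv' //.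
  by have : (0 : R) <= n%:R by []; nra.
have per j : 1 - cos (wave b u v (j + n)%N%:R) = 1 - cos (wave b u v j%:R).
  by rewrite /wave cosMnDl ?sinMnDl.
have : \sum_(j < n) (1 - cos (wave b u' v' j%:R)) <=
   2 * \sum_(j < n) (1 - cos (wave b u v (j + l)%N%:R)) +
   2 * \sum_(j < n) (1 - cos (wave b u v j%:R)).
  rewrite !mulr_sumr -big_split; apply: ler_sum => j _ /=.
  by rewrite wE; exact: onemcosB_le.
rewrite (@sum_periodic_shift n l (fun j => 1 - cos (wave b u v j%:R))) //.
lra.
Qed.

Definition rootangle n (k : nat) : R := 2 * pi * k%:R / n%:R.

Lemma cos_2piM k : cos (2 * pi * k%:R : R) = 1.
Proof.
by rewrite -[LHS]/(cos _) -[_ * _]add0r mulr_natr mulr_natl (periodicn (@cosD2pi R)) cos0.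
Qed.

Lemma rootangle_full n k : (0 < n)%N -> cos (n%:R * rootangle n k) = 1.
Proof.
move=> n0; rewrite /rootangle mulrC divfK ?cos_2piM // pnatr_eq0 -lt0n //.
Qed.

Lemma cos_rootangle_neq1 n a : (0 < n)%N -> ~~ (n %| a)%N -> cos (rootangle n a) != 1.
Proof.
move=> n0 na; have nR : n%:R != 0 :> R by rewrite pnatr_eq0 -lt0n.
have -> : cos (rootangle n a) = cos (rootangle n (a %% n)).
  rewrite {1}(divn_eq a n) /rootangle natrD natrM.
  have -> : 2 * pi * ((a %/ n)%:R * n%:R + (a %% n)%:R) / n%:R =
     2 * pi * (a %% n)%:R / n%:R + 2 * pi * (a %/ n)%:R :> R by field.
  by rewrite [2 * pi * (a %/ n)%:R]mulr_natr mulr_natl (periodicn (@cosD2pi R)).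
have r0 : (0 < a %% n)%N by rewrite lt0n.
have rn := ltn_pmod a n0.
rewrite lt_eqF // -subr_gt0 cosB1_sin mulr_gt0 // exprn_gt0 // sin_gt0_pi //.
have p0 := pi_gt0 R; have nR0 : (0 : R) < n%:R by rewrite ltr0n.
have -> : rootangle n (a %% n) / 2 = pi * ((a %% n)%:R / n%:R) by rewrite /rootangle; field.
rewrite mulr_gt0 //= ?divr_gt0 ?ltr0n //.
by rewrite gtr_pMr // ltr_pdivrMr // mul1r ltr_nat.
Qed.

Lemma rootangleM n k j : j%:R * rootangle n k = rootangle n (j * k).
Proof. by rewrite /rootangle natrM; ring. Qed.

(** By Bezout some multiple of [k] is [- gcd(n, k)] modulo [n], and the cosine ignores the sign.
    This supplies a short nonzero step among the multiples of the angle. *)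
Lemma exists_rootangle_gcd n k : (0 < n)%N ->
  exists j, cos (j%:R * rootangle n k) = cos (rootangle n (gcdn n k)).
Proof.
move=> n0; have [j _ /dvdnP[c hc]] := Bezoutl k n0.
exists j; rewrite rootangleM.
have nR : n%:R != 0 :> R by rewrite pnatr_eq0 -lt0n.
have -> : rootangle n (j * k) = 2 * pi * c%:R - rootangle n (gcdn n k).
  have : (gcdn n k)%:R + (j * k)%:R = c%:R * n%:R :> R by rewrite -natrD hc natrM.
  by move=> /(canRL (addKr _)) E; rewrite /rootangle E; field.
by rewrite cosB cos_2piM (cos1sin0 (x := 2 * pi * c%:R)) ?cos_2piM ?normr1 // mul1r mul0r addr0.
Qed.

Lemma chord_rootangle_le n a : 2 - 2 * cos (rootangle n a) <= (8 * a%:R / n%:R) ^+ 2 :> R.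
Proof.
have := onemcos_le (rootangle n a).
have : rootangle n a ^+ 2 <= (8 * a%:R / n%:R) ^+ 2 :> R.
  have p0 := pi_gt0 R; have := pihalf_lt2 R.
  rewrite /rootangle => p2.
  have nn : (0:R) <= a%:R / n%:R by rewrite divr_ge0.
  have -> : 2 * pi * a%:R / n%:R = (2 * pi) * (a%:R / n%:R) :> R by ring.
  have -> : 8 * a%:R / n%:R = 8 * (a%:R / n%:R) :> R by ring.
  by rewrite lerXn2r ?nnegrE ?mulr_ge0 ?ler_wpM2r //; lra.
lra.
Qed.

End Trigonometry.

(** * Singular values of circulant matrices through the Fourier transform *)

Section CirculantSpectrum.
Context {R : realType}.
Implicit Types (n : nat) (a : nat -> R) (b t : R).

Definition dft_re n a b : R := \sum_(j < n) a j * cos (j%:R * b).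
Definition dft_im n a b : R := \sum_(j < n) a j * sin (j%:R * b).
Definition dft_sq n a b : R := dft_re n a b ^+ 2 + dft_im n a b ^+ 2.

(** Orthogonality of the characters of [Z/n], in real part. *)
Lemma sum_cos_rootangle_diff n (i j : 'I_n) :
  \sum_(k < n) cos (i%:R * rootangle n k - j%:R * rootangle n k) = (i == j)%:R * n%:R :> R.
Proof.
have n0 : (0 < n)%N by case: n i {j} => [[]|].
wlog ji : i j / (j <= i)%N => [h|].
  have [/h//|/ltnW/h] := leqP j i; rewrite eq_sym => <-.
  by apply: eq_bigr => k _; rewrite -cosN opprB.
rewrite (eq_bigr (fun k : 'I_n => cos (k%:R * rootangle n (i - j)))); last first.
  move=> k _; congr cos; rewrite /rootangle natrB //.
  by ring.
have [->|ij] := eqVneq i j.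
  under eq_bigr do rewrite subnn /rootangle mulr0 mul0r mulr0 cos0.
  by rewrite sumr_const card_ord mul1r.
have nij : ~~ (n %| i - j)%N.
  rewrite gtnNdvd ?subn_gt0 // ?(leq_ltn_trans (leq_subr _ _)) //.
  by rewrite ltn_neqAle ji andbT eq_sym; exact: ij.
have [-> _] := @sum_cos_sin_eq0 R n _ (rootangle_full n (i - j) n0) (cos_rootangle_neq1 n _ n0 nij).
by rewrite mul0r.
Qed.

Lemma parseval n (y : 'I_n -> R) :
  \sum_(k < n) ((\sum_(i < n) y i * cos (i%:R * rootangle n k)) ^+ 2 +
                (\sum_(i < n) y i * sin (i%:R * rootangle n k)) ^+ 2) =
  n%:R * \sum_(i < n) y i ^+ 2.
Proof.
transitivity (\sum_(k < n) \sum_(i < n) \sum_(j < n)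
    y i * y j * cos (i%:R * rootangle n k - j%:R * rootangle n k)).
  apply: eq_bigr => k _; rewrite !expr2 !big_distrlr /= -big_split.
  apply: eq_bigr => i _; rewrite -big_split; apply: eq_bigr => j _ /=.
  by rewrite cosB; ring.
rewrite exchange_big /= mulr_sumr; apply: eq_bigr => i _.
rewrite exchange_big /= (bigD1 i) //= -mulr_sumr sum_cos_rootangle_diff eqxx mul1r.
rewrite big1 ?addr0 => [|j ji]; first by rewrite expr2 mulrC.
by rewrite -mulr_sumr sum_cos_rootangle_diff eq_sym (negbTE ji) mul0r mulr0.
Qed.

Lemma sum_circulant_row n a (i : 'I_n) (g : nat -> R) : (forall j, g (j + n)%N = g j) ->
  \sum_(j < n) circulant n a i j * g j = \sum_(l < n) a l * g (l + i)%N.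
Proof.
move=> gn; pose F j := a ((j + n - i) %% n)%N * g j.
transitivity (\sum_(j < n) F j); first by apply: eq_bigr => j _; rewrite mxE.
rewrite -(sum_periodic_shift n i F) => [|j]; last first.
  by rewrite /F gn -addnBAC ?modnDr // ltnW // ltn_addl.
apply: eq_bigr => j _; rewrite /F.
by rewrite addnAC addnK modnDr modn_small.
Qed.

(** Reversing the summation index turns the reflection [i -> j - i] into a shift, which is harmless
    by periodicity. *)
Lemma sum_modn_reflect n (j : 'I_n) (g : nat -> R) : (forall i, g (i + n)%N = g i) ->
  \sum_(i < n) g ((j + n - i) %% n)%N = \sum_(l < n) g l.
Proof.
move=> gn; rewrite -(sum_periodic_shift n j.+1 g) // (reindex_inj rev_ord_inj) /=.
apply: eq_bigr => i _.
have -> : (j + n - (n - i.+1))%N = (i + j.+1)%N.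
  by rewrite -addnBA ?leq_subr // subKn // addnC addSnnS.
have gM q r : g (q * n + r)%N = g r.
  by elim: q => [|q IH]; rewrite ?mul0n // mulSn -addnA addnC gn.
by rewrite {2}(divn_eq (i + j.+1) n) gM.
Qed.


(** The matrix acts by correlation with its first row, so the transform of the image is the
    transform of [x] times the conjugate of that of [a]. Only squared moduli are recorded. *)
Lemma dft_circulant n a (x : 'I_n -> R) (k : 'I_n) :
  let b := rootangle n k in
  let y i := \sum_(j < n) circulant n a i j * x j in
  (\sum_(i < n) y i * cos (i%:R * b)) ^+ 2 + (\sum_(i < n) y i * sin (i%:R * b)) ^+ 2 =
  dft_sq n a b * ((\sum_(i < n) x i * cos (i%:R * b)) ^+ 2 +
                  (\sum_(i < n) x i * sin (i%:R * b)) ^+ 2).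
Proof.
move=> b y; have n0 : (0 < n)%N by case: n k {b y x} => [[]|].
have hb : cos (n%:R * b) = 1 by exact: rootangle_full.
(* The number [q] counts the multiples of [n] removed when [j + n - i] is reduced; each one amounts
   to [k] full turns. *)
have angle (i j : 'I_n) : exists q : nat,
    i%:R * b = (j%:R * b - ((j + n - i) %% n)%:R * b) + 2 * pi * k%:R - 2 * pi * (k * q)%:R.
  exists ((j + n - i) %/ n)%N.
  have : ((j + n - i) %/ n)%:R * n%:R + ((j + n - i) %% n)%:R = j%:R + n%:R - i%:R :> R.
    transitivity ((j + n - i)%N%:R : R); first by rewrite {3}(divn_eq (j + n - i) n) natrD natrM.
    by rewrite natrB ?natrD // ltnW // ltn_addl.
  move=> E; have nR : n%:R != 0 :> R by rewrite pnatr_eq0 -lt0n.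
  rewrite natrM.
  have -> : ((j + n - i) %% n)%:R = j%:R + n%:R - i%:R - ((j + n - i) %/ n)%:R * n%:R :> R.
    by rewrite -E; ring.
  by rewrite /b /rootangle; field.
have s2 q : sin (2 * pi * q%:R : R) = 0 by apply: cos1sin0; rewrite cos_2piM normr1.
have cosE (i j : 'I_n) : cos (i%:R * b) = cos (j%:R * b - ((j + n - i) %% n)%:R * b).
  have [q ->] := angle i j.
  by rewrite cosB cosD sinD !cos_2piM !s2; ring.
have sinE (i j : 'I_n) : sin (i%:R * b) = sin (j%:R * b - ((j + n - i) %% n)%:R * b).
  have [q ->] := angle i j.
  by rewrite sinB cosD sinD !cos_2piM !s2; ring.
(* Cosine and sine are treated together. For fixed [j] the substitution [l = (j - i) mod n]
   separates the sum over the row from the sum over [x]. *)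
have red (f : R -> R) : (forall i j : 'I_n, f (i%:R * b) = f (j%:R * b - ((j + n - i) %% n)%:R * b)) ->
    (forall x, f (x - n%:R * b) = f x) ->
   \sum_(i < n) y i * f (i%:R * b) =
   \sum_(j < n) x j * \sum_(l < n) a l * f (j%:R * b - l%:R * b).
  move=> fE fper; rewrite /y; under eq_bigr do rewrite mulr_suml.
  rewrite exchange_big /=; apply: eq_bigr => j _; rewrite mulr_sumr.
  pose g l := x j * (a (l %% n)%N * f (j%:R * b - (l %% n)%N%:R * b)).
  transitivity (\sum_(i < n) g ((j + n - i) %% n)%N).
    by apply: eq_bigr => i _; rewrite mxE /g modn_mod -fE; ring.
  rewrite sum_modn_reflect => [|l]; last by rewrite /g modnDr.
  by apply: eq_bigr => l _; rewrite /g modn_small.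
have sn : sin (n%:R * b) = 0 by apply: cos1sin0; rewrite hb normr1.
rewrite (red (@cos R)) //; last by move=> z; rewrite cosB hb sn; ring.
rewrite (red (@sin R)) //; last by move=> z; rewrite sinB hb sn; ring.
set Xc := \sum_(i < n) x i * cos _; set Xs := \sum_(i < n) x i * sin _.
have -> : \sum_(j < n) x j * \sum_(l < n) a l * cos (j%:R * b - l%:R * b) =
    Xc * dft_re n a b + Xs * dft_im n a b.
  rewrite /Xc /Xs !mulr_suml -big_split; apply: eq_bigr => j _ /=.
  rewrite /dft_re /dft_im !mulr_sumr -big_split; apply: eq_bigr => l _ /=.
  by rewrite cosB; ring.
have -> : \sum_(j < n) x j * \sum_(l < n) a l * sin (j%:R * b - l%:R * b) =
    Xs * dft_re n a b - Xc * dft_im n a b.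
  rewrite /Xc /Xs !mulr_suml -sumrB; apply: eq_bigr => j _ /=.
  rewrite /dft_re /dft_im !mulr_sumr -sumrB; apply: eq_bigr => l _ /=.
  by rewrite sinB; ring.
by rewrite /dft_sq; ring.
Qed.

Lemma vnorm2_sqr n (x : 'cV[R]_n) : vnorm2 x ^+ 2 = \sum_(i < n) x i 0 ^+ 2.
Proof. by rewrite /vnorm2 sqr_sqrtr // sumr_ge0 // => i _; exact: sqr_ge0. Qed.

Lemma vnorm2_ge0 n (x : 'cV[R]_n) : 0 <= vnorm2 x.
Proof. exact: sqrtr_ge0. Qed.

Lemma vnorm2_scale n (c : R) (x : 'cV[R]_n) : 0 <= c -> vnorm2 (c *: x) = c * vnorm2 x.
Proof.
move=> c0; apply/eqP; rewrite -(@eqrXn2 _ 2) ?mulr_ge0 ?vnorm2_ge0 //.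
rewrite exprMn !vnorm2_sqr mulr_sumr; apply/eqP/eq_bigr => i _.
by rewrite mxE exprMn.
Qed.

Lemma vnorm2_circulant_ge n a (m : R) (x : 'cV[R]_n) :
  (forall k : 'I_n, m <= dft_sq n a (rootangle n k)) ->
  m * vnorm2 x ^+ 2 <= vnorm2 (circulant n a *m x) ^+ 2.
Proof.
move=> hm; rewrite !vnorm2_sqr.
case: n x hm => [|n] x hm; first by rewrite !big_ord0 mulr0.
have n0 : (0 : R) < n.+1%:R by rewrite ltr0n.
rewrite -(ler_pM2l n0) mulrCA -parseval.
have -> : \sum_(i < n.+1) (circulant n.+1 a *m x) i 0 ^+ 2 =
   \sum_(i < n.+1) (\sum_(j < n.+1) circulant n.+1 a i j * x j 0) ^+ 2.
  by apply: eq_bigr => i _; rewrite mxE.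
rewrite -parseval mulr_sumr; apply: ler_sum => k _.
rewrite (dft_circulant n.+1 a (fun j => x j 0)) ler_wpM2r //.
by rewrite addr_ge0 ?sqr_ge0.
Qed.

(** The real and imaginary parts [x], [y] of the complex eigenvector [e^{ijb}] have images whose
    squared norms add up to exactly [dft_sq] times the sum of theirs. Hence one of the two is
    stretched by no more than the eigenvalue. *)
Lemma exists_vnorm2_circulant_le n a (k : 'I_n) : exists2 x : 'cV[R]_n,
  0 < vnorm2 x & vnorm2 (circulant n a *m x) ^+ 2 <= dft_sq n a (rootangle n k) * vnorm2 x ^+ 2.
Proof.
have n0 : (0 < n)%N by case: n k => [[]|].
set b := rootangle n k; have hb : cos (n%:R * b) = 1 by exact: rootangle_full.
pose x : 'cV[R]_n := \col_j cos (j%:R * b); pose y : 'cV[R]_n := \col_j sin (j%:R * b).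
have xE i : (circulant n a *m x) i 0 = cos (i%:R * b) * dft_re n a b - sin (i%:R * b) * dft_im n a b.
  rewrite mxE (eq_bigr (fun j : 'I_n => circulant n a i j * cos (j%:R * b))); last first.
    by move=> j _; rewrite [x _ _]mxE.
  rewrite (sum_circulant_row n a i (fun j => cos (j%:R * b))); last by move=> j; exact: cosMnDl.
  rewrite /dft_re /dft_im !mulr_sumr -sumrB; apply: eq_bigr => l _.
  by rewrite natrD mulrDl cosD; ring.
have yE i : (circulant n a *m y) i 0 = sin (i%:R * b) * dft_re n a b + cos (i%:R * b) * dft_im n a b.
  rewrite mxE (eq_bigr (fun j : 'I_n => circulant n a i j * sin (j%:R * b))); last first.
    by move=> j _; rewrite [y _ _]mxE.
  rewrite (sum_circulant_row n a i (fun j => sin (j%:R * b))); last by move=> j; exact: sinMnDl.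
  rewrite /dft_re /dft_im !mulr_sumr -big_split; apply: eq_bigr => l _ /=.
  by rewrite natrD mulrDl sinD; ring.
have tot : vnorm2 (circulant n a *m x) ^+ 2 + vnorm2 (circulant n a *m y) ^+ 2 =
   dft_sq n a b * vnorm2 x ^+ 2 + dft_sq n a b * vnorm2 y ^+ 2.
  rewrite !vnorm2_sqr !mulr_sumr -!big_split; apply: eq_bigr => i _ /=.
  by rewrite xE yE !mxE /dft_sq; ring.
have [hx|hx] := leP (vnorm2 (circulant n a *m x) ^+ 2) (dft_sq n a b * vnorm2 x ^+ 2).
  exists x => //; rewrite lt_def vnorm2_ge0 andbT -sqrf_eq0 vnorm2_sqr.
  case: n n0 k b hb @x @y xE yE tot hx => // n _ k b hb x y _ _ _ _.
  rewrite big_ord_recl gt_eqF // mxE mul0r cos0 expr1n ltr_pwDl // sumr_ge0 // => i _.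
  exact: sqr_ge0.
(* The strict inequality also excludes [y = 0], which happens when [e^{ib}] is real. *)
have hy : vnorm2 (circulant n a *m y) ^+ 2 < dft_sq n a b * vnorm2 y ^+ 2 by lra.
exists y; last exact: ltW.
rewrite lt_def vnorm2_ge0 andbT; apply/eqP => y0; move: hy; rewrite y0 expr0n mulr0.
by rewrite ltNge sqr_ge0.
Qed.

(** As [sigma_min] is an infimum, a strict lower bound requires a gap: if all values of [dft_sq]
    exceed [t^2], the least of these finitely many values bounds every stretch from below. *)
Lemma sigma_min_circulant_le n a t : (0 < n)%N -> 0 <= t ->
  sigma_min (circulant n a) <= t <->
  exists k : 'I_n, dft_sq n a (rootangle n k) <= t ^+ 2.
Proof.
move=> n0 t0; rewrite /sigma_min; set S := image _ _.
have normalize (x : 'cV[R]_n) : 0 < vnorm2 x -> S (vnorm2 (circulant n a *m x) / vnorm2 x).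
  move=> x0; exists ((vnorm2 x)^-1 *: x) => /=.
    by rewrite vnorm2_scale ?invr_ge0 ?ltW // mulVf // gt_eqF.
  by rewrite -scalemxAr vnorm2_scale ?invr_ge0 ?ltW // mulrC.
have S0 : S !=set0.
  by have [x x0 _] := exists_vnorm2_circulant_le n a (Ordinal n0); eexists; exact: normalize x0.
have lbS : lbound S 0 by move=> _ [x _ <-]; exact: vnorm2_ge0.
split => [|[k hk]]; last first.
  have [x x0 hx] := exists_vnorm2_circulant_le n a k.
  apply: (@le_trans _ _ (vnorm2 (circulant n a *m x) / vnorm2 x)).
    by apply: ge_inf; [exists 0|exact: normalize].
  rewrite ler_pdivrMr // -(@ler_pXn2r _ 2) ?nnegrE ?vnorm2_ge0 ?mulr_ge0 ?vnorm2_ge0 //.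
  rewrite exprMn; apply: le_trans hx _.
  by rewrite ler_wpM2r ?sqr_ge0.
apply: contraPP => /forallNP hk.
pose F (k : 'I_n) := dft_sq n a (rootangle n k).
pose k0 : 'I_n := Ordinal n0.
have [km _ hmin] : exists2 k, true & forall j, F k <= F j.
  by exists [arg min_(k < k0) F k]%O => //; case: arg_minP => // i _ h j; exact: h.
have : t ^+ 2 < F km by rewrite ltNge; apply/negP; exact: hk.
move=> tF; have F0 : 0 <= F km by rewrite addr_ge0 ?sqr_ge0.
apply/negP; rewrite -ltNge; apply: (@lt_le_trans _ _ (Num.sqrt (F km))).
  by rewrite -(@ltr_pXn2r _ 2) ?nnegrE ?sqrtr_ge0 // sqr_sqrtr.
apply: lb_le_inf => // _ [x /= x1 <-].
rewrite -(@ler_pXn2r _ 2) ?nnegrE ?sqrtr_ge0 ?vnorm2_ge0 // sqr_sqrtr //.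
by have := vnorm2_circulant_ge n a (F km) x hmin; rewrite x1 expr1n mulr1.
Qed.

End CirculantSpectrum.

(** * Expectations of bounded random variables *)

Section BoundedExpectation.
Context {R : realType} {d : measure_display} {T : measurableType d} (P : probability T R).
Implicit Types (f g W X Y : T -> R).

Definition bounded_measurable f : Prop :=
  measurable_fun setT f /\ exists K : R, forall w, `|f w| <= K.

Definition mean f : R := \int[P]_w f w.

Lemma bm_integrable f : bounded_measurable f -> P.-integrable setT (EFin \o f).
Proof.
move=> [mf [K hK]]; apply: measurable_bounded_integrable => //.
  by rewrite (le_lt_trans (probability_le1 P measurableT)) // ltry.
by exists K; split => [|M KM w _ /=]; [exact: num_real|exact: le_trans (hK w) (ltW KM)].
Qed.

Lemma bm_cst (c : R) : bounded_measurable (fun=> c).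
Proof. by split => //; exists `|c|. Qed.

Lemma bm_le1 f : measurable_fun setT f -> (forall w, `|f w| <= 1) -> bounded_measurable f.
Proof. by move=> mf h; split => //; exists 1. Qed.

Lemma bmD f g : bounded_measurable f -> bounded_measurable g ->
  bounded_measurable (fun w => f w + g w).
Proof.
move=> [mf [K hK]] [mg [L hL]]; split; first exact: measurable_funD.
by exists (K + L) => w; rewrite (le_trans (ler_normD _ _)) // lerD.
Qed.

Lemma bmM f g : bounded_measurable f -> bounded_measurable g ->
  bounded_measurable (fun w => f w * g w).
Proof.
move=> [mf [K hK]] [mg [L hL]]; split; first exact: measurable_funM.
by exists (K * L) => w; rewrite normrM ler_pM.
Qed.

Lemma bmZ (c : R) f : bounded_measurable f -> bounded_measurable (fun w => c * f w).
Proof. by move=> hf; apply: bmM => //; exact: bm_cst. Qed.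

Lemma bmB f g : bounded_measurable f -> bounded_measurable g ->
  bounded_measurable (fun w => f w - g w).
Proof.
move=> hf hg; rewrite (_ : (fun w => _) = (fun w => f w + (-1) * g w)); last first.
  by apply/funext => w; rewrite mulN1r.
by apply: bmD => //; exact: bmZ.
Qed.

Lemma bm_sum (I : Type) (s : seq I) (F : I -> T -> R) :
  (forall i, bounded_measurable (F i)) -> bounded_measurable (fun w => \sum_(i <- s) F i w).
Proof.
move=> hF; elim: s => [|i s IH].
  by under eq_fun do rewrite big_nil; exact: bm_cst.
by under eq_fun do rewrite big_cons; exact: bmD.
Qed.

Lemma bm_prod (I : Type) (s : seq I) (F : I -> T -> R) :
  (forall i, bounded_measurable (F i)) -> bounded_measurable (fun w => \prod_(i <- s) F i w).
Proof.
move=> hF; elim: s => [|i s IH].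
  by under eq_fun do rewrite big_nil; exact: bm_cst.
by under eq_fun do rewrite big_cons; exact: bmM.
Qed.

Lemma indic_le1 (U : Type) (A : set U) (x : U) : `|\1_A x| <= 1 :> R.
Proof. by rewrite indicE; case: (x \in A); rewrite ?normr1 ?normr0. Qed.

Lemma bm_indic (A : set T) : measurable A -> bounded_measurable (\1_A).
Proof.
by move=> mA; apply: bm_le1 => [|w]; [exact: measurable_indic|exact: indic_le1].
Qed.

Lemma bm_comp (h : R -> R) X : measurable_fun setT h -> (forall x, `|h x| <= 1) ->
  measurable_fun setT X -> bounded_measurable (fun w => h (X w)).
Proof.
by move=> mh h1 mX; apply: bm_le1 => // ; exact: measurableT_comp.
Qed.

Lemma bm_indic_comp (A : set R) X : measurable A -> measurable_fun setT X ->
  bounded_measurable (fun w => \1_A (X w)).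
Proof.
move=> mA mX; apply: (bm_comp (\1_A)) mX; first exact: measurable_indic.
by move=> x; exact: indic_le1.
Qed.

Lemma measurable_cosR : measurable_fun setT (@cos R).
Proof. by apply: continuous_measurable_fun; exact: continuous_cos. Qed.

Lemma measurable_sinR : measurable_fun setT (@sin R).
Proof. by apply: continuous_measurable_fun; exact: continuous_sin. Qed.

Lemma bm_cos X : measurable_fun setT X -> bounded_measurable (fun w => cos (X w)).
Proof. by move=> mX; apply: bm_comp => //; [exact: measurable_cosR|exact: cos_max]. Qed.

Lemma bm_sin X : measurable_fun setT X -> bounded_measurable (fun w => sin (X w)).
Proof. by move=> mX; apply: bm_comp => //; [exact: measurable_sinR|exact: sin_max]. Qed.

Lemma mean_eq f g : (forall w, f w = g w) -> mean f = mean g.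
Proof. by move=> fg; congr (mean _); apply/funext. Qed.

Lemma meanD f g : bounded_measurable f -> bounded_measurable g ->
  mean (fun w => f w + g w) = mean f + mean g.
Proof. by move=> hf hg; rewrite /mean RintegralD //; exact: bm_integrable. Qed.

Lemma meanB f g : bounded_measurable f -> bounded_measurable g ->
  mean (fun w => f w - g w) = mean f - mean g.
Proof. by move=> hf hg; rewrite /mean RintegralB //; exact: bm_integrable. Qed.

Lemma meanZ (c : R) f : bounded_measurable f -> mean (fun w => c * f w) = c * mean f.
Proof. by move=> hf; rewrite /mean RintegralZl //; exact: bm_integrable. Qed.

Lemma mean_cst (c : R) : mean (fun=> c) = c.
Proof.
transitivity (c * fine (P setT)); first exact: Rintegral_cst.
by rewrite probability_setT mulr1.
Qed.

Lemma mean_le f g : bounded_measurable f -> bounded_measurable g ->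
  (forall w, f w <= g w) -> mean f <= mean g.
Proof. by move=> hf hg fg; apply: le_Rintegral => //; exact: bm_integrable. Qed.

Lemma mean_sum (I : Type) (s : seq I) (F : I -> T -> R) :
  (forall i, bounded_measurable (F i)) ->
  mean (fun w => \sum_(i <- s) F i w) = \sum_(i <- s) mean (F i).
Proof.
move=> hF; elim: s => [|i s IH].
  by rewrite big_nil -[RHS]mean_cst; apply: mean_eq => w; rewrite big_nil.
rewrite big_cons -IH -meanD //; last exact: bm_sum.
by apply: mean_eq => w; rewrite big_cons.
Qed.

Lemma mean_indic (A : set T) : measurable A -> mean (\1_A) = fine (P A).
Proof. by move=> mA; rewrite /mean /Rintegral integral_indic // setIT. Qed.

Lemma prob_mean (A : set T) : measurable A -> P A = (mean (\1_A))%:E.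
Proof. by move=> mA; rewrite mean_indic // fineK // fin_num_measure. Qed.

Lemma mean_dist f g (e : R) : bounded_measurable f -> bounded_measurable g ->
  (forall w, `|f w - g w| <= e) -> `|mean f - mean g| <= e.
Proof.
move=> hf hg fg; rewrite -meanB //; have hfg := bmB f g hf hg.
rewrite ler_norml -{1}[- e]mean_cst -{2}[e]mean_cst.
rewrite !mean_le //; try exact: bm_cst.
  by move=> w; have := fg w; rewrite ler_norml => /andP[].
by move=> w; have := fg w; rewrite ler_norml => /andP[].
Qed.

(** The sum is the integer part of [z]. With [z = N f(x)] it approximates [f] by level sets;
    [z <= N] ensures that the count is not cut short. *)
Lemma count_le_bounds (N : nat) (z : R) : 0 <= z <= N%:R ->
  z - 1 <= \sum_(i < N) ((i.+1)%:R <= z)%R%:R <= z.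
Proof.
move=> /andP[z0 zN]; apply/andP; split; last first.
  elim: N {zN} => [|N IH]; first by rewrite big_ord0.
  have [Nz|Nz] := leP (N.+1%:R) z; last by rewrite big_ord_recr /= (lt_geF Nz) addr0.
  apply: le_trans Nz; rewrite -[X in _ <= X%:R]card_ord -sumr_const ler_sum // => i _.
  by rewrite lern1 leq_b1.
elim: N zN => [|N IH] zN; first by rewrite big_ord0; lra.
have [zN'|zN'] := leP z (N%:R).
  by rewrite big_ord_recr /=; apply: le_trans (IH zN') _; rewrite lerDl.
apply: (@le_trans _ _ (N%:R)); first by move: zN; rewrite -natr1; lra.
rewrite big_ord_recr /= -[leLHS]addr0 lerD //.
rewrite -[X in X%:R <= _]card_ord -sumr_const ler_sum // => i _.
by have -> : (i.+1%:R <= z) = true by rewrite (le_trans _ (ltW zN')) // ler_nat.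
Qed.

(* A function with values in [0, 1] is within 1/N of an average of N indicators. *)
Lemma mean_ext_indic W1 W2 X1 X2 (f : R -> R) :
  bounded_measurable W1 -> bounded_measurable W2 ->
  measurable_fun setT X1 -> measurable_fun setT X2 ->
  (forall A, measurable A ->
     mean (fun w => W1 w * \1_A (X1 w)) = mean (fun w => W2 w * \1_A (X2 w))) ->
  measurable_fun setT f -> (forall x, `|f x| <= 1) ->
  mean (fun w => W1 w * f (X1 w)) = mean (fun w => W2 w * f (X2 w)).
Proof.
move=> hW1 hW2 mX1 mX2 hA.
wlog f0 : f / (forall x, 0 <= f x).
  move=> hwlog mf f1.
  (* The affine map takes [[-1, 1]] to [[0, 1]]; its constant term is handled by the hypothesis on
     indicators for the whole line. *)
  pose g x := 1 / 2 * (f x + 1).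
  have fb x : -1 <= f x <= 1 by rewrite -ler_norml.
  have mg : measurable_fun setT g by apply: measurable_funM => //; exact: measurable_funD.
  have bf W X : bounded_measurable W -> measurable_fun setT X ->
      mean (fun w => W w * f (X w)) = 2 * mean (fun w => W w * g (X w)) - mean (fun w => W w * \1_setT (X w)).
    move=> hW mX.
    have b1 : bounded_measurable (fun w => W w * g (X w)).
      by apply: bmM => //; apply: bm_comp => // x; rewrite ler_norml /g; have := fb x; lra.
    have b2 : bounded_measurable (fun w => W w * \1_setT (X w)).
      by apply: bmM => //; exact: bm_indic_comp.
    rewrite -meanZ // -meanB //; last exact: bmZ.
    by apply: mean_eq => w; rewrite indicT /g /=; lra.
  rewrite !bf // hA // (hwlog g) // => x; first by rewrite /g; have := fb x; lra.
  by rewrite ler_norml /g; have := fb x; lra.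
move=> mf f1.
have f01 x : 0 <= f x <= 1 by rewrite f0 /=; have := f1 x; rewrite ger0_norm.
have [_ [K1 hK1]] := hW1; have [_ [K2 hK2]] := hW2.
pose A N i := [set x : R | (i.+1)%:R <= N.+1%:R * f x].
have mA N i : measurable (A N i).
  rewrite -[A N i]setTI; apply: (measurable_fun_ler (f := cst _)) => //.
  by apply: measurable_funM.
pose fN N x : R := (N.+1)%:R^-1 * \sum_(i < N.+1) \1_(A N i) x.
have fNf N x : `|f x - fN N x| <= N.+1%:R^-1.
  have N0 : (0 : R) < N.+1%:R by rewrite ltr0n.
  have := @count_le_bounds N.+1 (N.+1%:R * f x).
  have -> : \sum_(i < N.+1) ((i.+1)%:R <= N.+1%:R * f x)%R%:R = \sum_(i < N.+1) \1_(A N i) x :> R.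
    apply: eq_bigr => i _; rewrite indicE /A; congr (nat_of_bool _)%:R.
    by apply/idP/idP; rewrite inE.
  rewrite /fN; set S := \sum_(i < _) _ => h.
  have {h} /andP[h1 h2] : N.+1%:R * f x - 1 <= S <= N.+1%:R * f x.
    by apply: h; have := f01 x; nra.
  have -> : f x - N.+1%:R^-1 * S = N.+1%:R^-1 * (N.+1%:R * f x - S).
    by rewrite mulrBr mulKf // gt_eqF.
  rewrite normrM gtr0_norm ?invr_gt0 //.
  apply: ler_piMr; first by rewrite invr_ge0 ltW.
  by rewrite ler_norml; lra.
have bmW W X N : bounded_measurable W -> measurable_fun setT X -> forall i,
    bounded_measurable (fun w => N.+1%:R^-1 * (W w * \1_(A N i) (X w))).
  move=> hW mX i; apply: bmZ; apply: bmM => //; exact: bm_indic_comp.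
have mNE W X N : bounded_measurable W -> measurable_fun setT X ->
   mean (fun w => W w * fN N (X w)) = \sum_(i < N.+1) N.+1%:R^-1 * mean (fun w => W w * \1_(A N i) (X w)).
  move=> hW mX; rewrite (eq_bigr (fun i : 'I_N.+1 => mean (fun w => N.+1%:R^-1 * (W w * \1_(A N i) (X w))))).
    rewrite -mean_sum; last exact: bmW.
    by apply: mean_eq => w; rewrite /fN !mulr_sumr; apply: eq_bigr => i _; ring.
  move=> i _; rewrite meanZ //; apply: bmM => //; exact: bm_indic_comp.
have near_mean W X K N : bounded_measurable W -> measurable_fun setT X -> (forall w, `|W w| <= K) ->
   `|mean (fun w => W w * f (X w)) - mean (fun w => W w * fN N (X w))| <= K / N.+1%:R.
  move=> hW mX hK; apply: mean_dist.
  - by apply: bmM => //; exact: bm_comp.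
  - rewrite (_ : (fun w => _) = (fun w => \sum_(i < N.+1) N.+1%:R^-1 * (W w * \1_(A N i) (X w)))).
      by apply: bm_sum; exact: bmW.
    by apply/funext => w; rewrite /fN !mulr_sumr; apply: eq_bigr => i _; ring.
  - by move=> w; rewrite -mulrBr normrM ler_pM.
apply/eqP; rewrite -subr_eq0 -normr_le0; apply/ler_addgt0Pl => e e0; rewrite addr0.
have K0 : 0 <= K1 + K2.
  have w : T := point.
  by apply: addr_ge0; [apply: le_trans (hK1 w)|apply: le_trans (hK2 w)].
pose N := Num.truncn ((K1 + K2) / e).
have hN : (K1 + K2) / N.+1%:R <= e.
  rewrite ler_pdivrMr ?ltr0n // mulrC -ler_pdivrMr //.
  by apply/ltW; rewrite /N truncnS_gt.
have := near_mean W1 X1 K1 N hW1 mX1 hK1; have := near_mean W2 X2 K2 N hW2 mX2 hK2.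
rewrite !mNE //.
under [X in _ - X]eq_bigr do rewrite -hA //.
set S := \sum_(i < _) _ => h2 h1.
have -> : forall x y : R, x - y = (x - S) - (y - S) by move=> *; ring.
apply: le_trans (ler_normB _ _) _; apply: le_trans (lerD h1 h2) _.
by rewrite -mulrDl.
Qed.

End BoundedExpectation.

(** * Characteristic functions of linear combinations of the variables *)

Section IidCharacteristic.
Context {R : realType} {d : measure_display} {T : measurableType d} (P : probability T R).
Context (xi : nat -> {RV P >-> R}).
Context (xi_indep : mutually_independent P (fun i => xi i : T -> R)).
Context (xi_id : identically_distributed P (fun i => xi i : T -> R)).
Implicit Types (W : T -> R) (A : nat -> set R) (th : nat -> R).

Let mxi i : measurable_fun setT (xi i : T -> R) := measurable_funPT (xi i).

(** Independence of [W] from the variables with index at least [k], tested on product events over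
    consecutive indices. This suffices to split off one variable at a time; taking the factors at
    [xi 0] builds in the common law. *)
Definition indep_from (k : nat) W : Prop :=
  bounded_measurable W /\
  forall m A, (forall i, measurable (A i)) ->
    mean P (fun w => W w * \prod_(i <- iota k m) \1_(A i) (xi i w)) =
    mean P W * \prod_(i <- iota k m) mean P (fun w => \1_(A i) (xi 0%N w)).

Lemma bm_prod_indic A (s : seq nat) : (forall i, measurable (A i)) ->
  bounded_measurable (fun w => \prod_(i <- s) (\1_(A i) (xi i w) : R)).
Proof. by move=> mA; apply: bm_prod => i; exact: bm_indic_comp. Qed.

Lemma mean_indic_comp (B : set R) (X : T -> R) : measurable B -> measurable_fun setT X ->
  mean P (fun w => \1_B (X w)) = fine (P (X @^-1` B)).
Proof.
move=> mB mX; rewrite -mean_indic; last by rewrite -[_ @^-1` _]setTI; exact: mX.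
by apply: mean_eq => w; rewrite !indicE; congr (nat_of_bool _)%:R; apply/idP/idP; rewrite !inE.
Qed.

Lemma mean_prod_indic A (s : seq nat) : uniq s -> (forall i, measurable (A i)) ->
  mean P (fun w => \prod_(i <- s) \1_(A i) (xi i w)) =
  \prod_(i <- s) mean P (fun w => \1_(A i) (xi 0%N w)).
Proof.
move=> us mA.
have mpre i : measurable (xi i @^-1` A i) by rewrite -[_ @^-1` _]setTI; exact: mxi.
have -> : \prod_(i <- s) mean P (fun w => \1_(A i) (xi 0%N w)) =
    fine (\prod_(i <- s) P (xi i @^-1` A i))%E.
  rewrite (eq_bigr (fun i => (fine (P (xi i @^-1` A i)))%:E)) => [|i _]; last first.
    by rewrite fineK // fin_num_measure.
  rewrite prodEFin /=; apply: eq_bigr => i _.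
  by rewrite mean_indic_comp // -(xi_id i).
rewrite -(xi_indep s A us mA).
have mI : measurable (\big[setI/setT]_(i <- s) (xi i @^-1` A i)) by exact: bigsetI_measurable.
rewrite -mean_indic //.
apply: mean_eq => w; elim: s {us mI} => [|i s IH].
  by rewrite !big_nil indicT.
by rewrite !big_cons indicI /= IH; congr (_ * _).
Qed.

Lemma indep_from0 : indep_from 0 (fun=> 1).
Proof.
split=> [|m A mA]; first exact: bm_cst.
rewrite mean_cst mul1r -mean_prod_indic ?iota_uniq //.
by apply: mean_eq => w; rewrite mul1r.
Qed.

(** For an indicator this is the hypothesis on [W] with one more index, and [mean_ext_indic] extends
    it to [f], comparing with the constant weight [mean P W * c]. The product over later indices is
    kept so that independence passes to [k + 1]. *)
Lemma mean_indep_from k W (f : R -> R) m A : indep_from k W ->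
  measurable_fun setT f -> (forall x, `|f x| <= 1) -> (forall i, measurable (A i)) ->
  mean P (fun w => W w * f (xi k w) * \prod_(i <- iota k.+1 m) \1_(A i) (xi i w)) =
  mean P W * mean P (fun w => f (xi 0%N w)) *
    \prod_(i <- iota k.+1 m) mean P (fun w => \1_(A i) (xi 0%N w)).
Proof.
move=> [bW hW] mf f1 mA.
set c := \prod_(i <- iota k.+1 m) mean _ _.
have bf : bounded_measurable (fun w => f (xi 0%N w)) by exact: bm_comp.
transitivity (mean P (fun w => mean P W * c * f (xi 0%N w))); last by rewrite meanZ //; ring.
rewrite -(@mean_ext_indic _ _ _ P (fun w => W w * \prod_(i <- iota k.+1 m) \1_(A i) (xi i w))
  (fun=> mean P W * c) (xi k) (xi 0%N)) //.
- by apply: mean_eq => w; ring.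
- by apply: bmM => //; exact: bm_prod_indic.
- exact: bm_cst.
- move=> B mB; rewrite meanZ; last exact: bm_indic_comp.
  pose A' i := if i == k then B else A i.
  have mA' i : measurable (A' i) by rewrite /A'; case: ifP.
  have E (G : nat -> set R -> R) :
      \prod_(i <- iota k.+1 m) G i (A' i) = \prod_(i <- iota k.+1 m) G i (A i).
    apply: eq_big_seq => i; rewrite mem_iota /A' => /andP[ki _].
    by rewrite gtn_eqF.
  have := hW m.+1 A' mA'; rewrite /= big_cons (E (fun i B => mean P (fun w => \1_B (xi 0%N w)))).
  rewrite -/c {2}/A' eqxx => h.
  transitivity (mean P W * (mean P (fun w => \1_B (xi 0%N w)) * c)); last by ring.
  rewrite -h; apply: mean_eq => w.
  by rewrite big_cons (E (fun i B => \1_B (xi i w))) {1}/A' eqxx; ring.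
Qed.

Lemma mean_indep_fromM k W (f : R -> R) : indep_from k W ->
  measurable_fun setT f -> (forall x, `|f x| <= 1) ->
  mean P (fun w => W w * f (xi k w)) = mean P W * mean P (fun w => f (xi 0%N w)).
Proof.
move=> hW mf f1; have := mean_indep_from k W f 0 (fun=> setT) hW mf f1 (fun=> measurableT).
by rewrite big_nil mulr1 => <-; apply: mean_eq => w; rewrite big_nil mulr1.
Qed.

Lemma indep_fromM k W (f : R -> R) : indep_from k W ->
  measurable_fun setT f -> (forall x, `|f x| <= 1) ->
  indep_from k.+1 (fun w => W w * f (xi k w)).
Proof.
move=> hW mf f1; split=> [|m A mA]; first by apply: bmM; [exact: hW.1|exact: bm_comp].
by rewrite mean_indep_from // mean_indep_fromM.
Qed.

Lemma indep_fromD k W1 W2 : indep_from k W1 -> indep_from k W2 ->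
  indep_from k (fun w => W1 w + W2 w).
Proof.
move=> [b1 h1] [b2 h2]; split=> [|m A mA]; first exact: bmD.
rewrite meanD // mulrDl -h1 // -h2 // -meanD; last 2 first.
- by apply: bmM => //; exact: bm_prod_indic.
- by apply: bmM => //; exact: bm_prod_indic.
by apply: mean_eq => w; rewrite mulrDl.
Qed.

Lemma indep_fromN k W : indep_from k W -> indep_from k (fun w => - W w).
Proof.
move=> [b h]; have NE (f : T -> R) : bounded_measurable f -> mean P (fun w => - f w) = - mean P f.
  by move=> bf; rewrite -mulN1r -meanZ //; apply: mean_eq => w; rewrite mulN1r.
split=> [|m A mA].
  by rewrite (_ : (fun w => - W w) = (fun w => -1 * W w)); [exact: bmZ|apply/funext => w; rewrite mulN1r].
rewrite NE // mulNr -h // -NE; last by apply: bmM => //; exact: bm_prod_indic.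
by apply: mean_eq => w; rewrite mulNr.
Qed.

Definition lincomb th k (w : T) : R := \sum_(j < k) xi j w * th j.

Definition ccos (t : R) : R := mean P (fun w => cos (xi 0%N w * t)).
Definition csin (t : R) : R := mean P (fun w => sin (xi 0%N w * t)).

Lemma measurable_cosM (t : R) : measurable_fun setT (fun x : R => cos (x * t)).
Proof. by apply: measurableT_comp; [exact: measurable_cosR|exact: measurable_funM]. Qed.

Lemma measurable_sinM (t : R) : measurable_fun setT (fun x : R => sin (x * t)).
Proof. by apply: measurableT_comp; [exact: measurable_sinR|exact: measurable_funM]. Qed.

Lemma lincombS th k w : lincomb th k.+1 w = lincomb th k w + xi k w * th k.
Proof. by rewrite /lincomb big_ord_recr. Qed.

(** The addition formulas mix cosine and sine, hence the joint induction. *)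
Lemma indep_from_lincomb th k :
  indep_from k (fun w => cos (lincomb th k w)) /\ indep_from k (fun w => sin (lincomb th k w)).
Proof.
elim: k => [|k [hc hs]].
  (* At length 0 the sine is the constant 0, obtained as [1 + (- 1)]. *)
  split; [have := indep_from0|have := indep_fromD _ _ _ indep_from0 (indep_fromN _ _ indep_from0)];
  congr (indep_from _ _); apply/funext => w; rewrite /lincomb big_ord0 ?cos0 ?sin0 //; ring.
split.
  rewrite (_ : (fun w => _) = (fun w => cos (lincomb th k w) * cos (xi k w * th k) +
     - (sin (lincomb th k w) * sin (xi k w * th k)))); last first.
    by apply/funext => w; rewrite lincombS cosD.
  apply: indep_fromD; last apply: indep_fromN.
    by apply: (indep_fromM _ _ (fun x => cos (x * th k))) => // [|x]; [exact: measurable_cosM|exact: cos_max].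
  by apply: (indep_fromM _ _ (fun x => sin (x * th k))) => // [|x]; [exact: measurable_sinM|exact: sin_max].
rewrite (_ : (fun w => _) = (fun w => sin (lincomb th k w) * cos (xi k w * th k) +
     cos (lincomb th k w) * sin (xi k w * th k))); last first.
  by apply/funext => w; rewrite lincombS sinD.
apply: indep_fromD.
  by apply: (indep_fromM _ _ (fun x => cos (x * th k))) => // [|x]; [exact: measurable_cosM|exact: cos_max].
by apply: (indep_fromM _ _ (fun x => sin (x * th k))) => // [|x]; [exact: measurable_sinM|exact: sin_max].
Qed.

Lemma mean_cos_sin_lincombS th k :
  mean P (fun w => cos (lincomb th k.+1 w)) =
    mean P (fun w => cos (lincomb th k w)) * ccos (th k) -
    mean P (fun w => sin (lincomb th k w)) * csin (th k) /\
  mean P (fun w => sin (lincomb th k.+1 w)) =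
    mean P (fun w => sin (lincomb th k w)) * ccos (th k) +
    mean P (fun w => cos (lincomb th k w)) * csin (th k).
Proof.
have [hc hs] := indep_from_lincomb th k.
have bc W : indep_from k W -> bounded_measurable (fun w => W w * cos (xi k w * th k)).
  by move=> [bW _]; apply: bmM => //; apply: bm_cos; exact: measurable_funM.
have bs W : indep_from k W -> bounded_measurable (fun w => W w * sin (xi k w * th k)).
  by move=> [bW _]; apply: bmM => //; apply: bm_sin; exact: measurable_funM.
have ec W : indep_from k W -> mean P (fun w => W w * cos (xi k w * th k)) = mean P W * ccos (th k).
  move=> hW; apply: (mean_indep_fromM _ _ (fun x => cos (x * th k))) => // [|x].
    exact: measurable_cosM.
  exact: cos_max.
have es W : indep_from k W -> mean P (fun w => W w * sin (xi k w * th k)) = mean P W * csin (th k).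
  move=> hW; apply: (mean_indep_fromM _ _ (fun x => sin (x * th k))) => // [|x].
    exact: measurable_sinM.
  exact: sin_max.
split.
  rewrite -ec // -es // -meanB; [|exact: bc|exact: bs].
  by apply: mean_eq => w; rewrite lincombS cosD.
rewrite -ec // -es // -meanD; [|exact: bc|exact: bs].
by apply: mean_eq => w; rewrite lincombS sinD.
Qed.

(** The squared modulus of a characteristic function is multiplicative over independent summands. *)
Lemma charfun_lincomb th k :
  mean P (fun w => cos (lincomb th k w)) ^+ 2 + mean P (fun w => sin (lincomb th k w)) ^+ 2 =
  \prod_(j < k) (ccos (th j) ^+ 2 + csin (th j) ^+ 2).
Proof.
elim: k => [|k IH].
  rewrite big_ord0 (mean_eq P _ (fun=> 1)) => [|w]; last by rewrite /lincomb big_ord0 cos0.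
  rewrite mean_cst (mean_eq P _ (fun=> 0)) => [|w]; last by rewrite /lincomb big_ord0 sin0.
  by rewrite mean_cst; ring.
rewrite big_ord_recr /= -IH; have [-> ->] := mean_cos_sin_lincombS th k.
ring.
Qed.

(** Symmetrisation: [|phi(t)|^2] is the characteristic function of [xi 0 - xi 1], seen as a
    combination of length 2 with coefficients [t] and [- t]. *)
Lemma charfun_sym (t : R) :
  ccos t ^+ 2 + csin t ^+ 2 = mean P (fun w => cos (t * (xi 0%N w - xi 1%N w))).
Proof.
pose th j := if j is 0%N then t else - t.
have [E _] := mean_cos_sin_lincombS th 1.
have [E1 E2] := mean_cos_sin_lincombS th 0.
have z0 w : lincomb th 0 w = 0 by rewrite /lincomb big_ord0.
have c0 : mean P (fun w => cos (lincomb th 0 w)) = 1.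
  by rewrite -(mean_cst P 1); apply: mean_eq => w; rewrite z0 cos0.
have s0 : mean P (fun w => sin (lincomb th 0 w)) = 0.
  by rewrite -(mean_cst P 0); apply: mean_eq => w; rewrite z0 sin0.
have -> : mean P (fun w => cos (t * (xi 0%N w - xi 1%N w))) = mean P (fun w => cos (lincomb th 2 w)).
  by apply: mean_eq => w; rewrite !lincombS z0 /th; congr cos; ring.
have cN : ccos (- t) = ccos t by apply: mean_eq => w; rewrite mulrN cosN.
have sN : csin (- t) = - csin t.
  rewrite -[RHS]mulN1r /csin -meanZ; last by apply: bm_sin; exact: measurable_funM.
  by apply: mean_eq => w; rewrite mulrN sinN mulN1r.
by rewrite E E1 E2 c0 s0 /= cN sN; ring.
Qed.

End IidCharacteristic.

(** * Decay of the characteristic function under condition (H) *)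

Section CharacteristicDecay.
Context {R : realType} {d : measure_display} {T : measurableType d} (P : probability T R).
Context (xi : nat -> {RV P >-> R}).
Context (xi_indep : mutually_independent P (fun i => xi i : T -> R)).
Context (xi_id : identically_distributed P (fun i => xi i : T -> R)).

Let mxi i : measurable_fun setT (xi i : T -> R) := measurable_funPT (xi i).

Lemma indic_bool (U : Type) (p : U -> bool) (x : U) : \1_[set y | p y] x = (p x)%:R :> R.
Proof. by rewrite indicE; congr (nat_of_bool _)%:R; apply/idP/idP; rewrite inE. Qed.

Lemma mean_indicM (A B : set R) : measurable A -> measurable B ->
  mean P (fun w => \1_A (xi 0%N w) * \1_B (xi 1%N w)) =
  mean P (fun w => \1_A (xi 0%N w)) * mean P (fun w => \1_B (xi 0%N w)).
Proof.
move=> mA mB; pose C i := if i == 0%N then A else B.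
have mC i : measurable (C i) by rewrite /C; case: ifP.
have := mean_prod_indic P xi xi_indep xi_id C [:: 0%N; 1%N] isT mC.
rewrite !big_cons !big_nil mulr1 /C /= => <-.
by apply: mean_eq => w; rewrite !big_cons big_nil mulr1.
Qed.

(** The lower bound on the symmetrised variable keeps cosine deficits away from 0; the upper bound
    keeps the amplitudes under control. *)
Definition spread_event (M : R) : set T :=
  [set w | (1 / 2 < `|xi 0%N w - xi 1%N w|) && (`|xi 0%N w - xi 1%N w| <= 2 * M)].

Lemma measurable_spread_event M : measurable (spread_event M).
Proof.
rewrite -[spread_event M]setTI; apply: measurable_and => //.
  by apply: measurable_fun_ltr => //; apply: measurableT_comp => //; exact: measurable_funB.
by apply: measurable_fun_ler => //; apply: measurableT_comp => //; exact: measurable_funB.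
Qed.

(* The half-unit cells covering [-M, M] turn the uniform bound on
   [P (|xi - u| <= 1)] into a bound on [P (|xi 0 - xi 1| <= 1/2)]. *)
Lemma spread_event_gt0 : condH P (xi 0%N) ->
  exists M p : R, [/\ 0 < M, 0 < p & p <= mean P (\1_(spread_event M))].
Proof.
move=> [M [q [M0 [/andP[q0 q1] [hU hM]]]]].
pose BM := [set x : R | `|x| <= M].
(* More than [4 M] cells of length [1/2], starting at [- M], reach beyond [M]. *)
pose K := (Num.truncn (4 * M)).+1.
pose lft i : R := - M + i%:R / 2.
pose B (i : nat) := [set x : R | [&& lft i <= x, x < lft i.+1 & `|x| <= M]].
pose U (i : nat) := [set x : R | `|x - lft i| <= 1].
have mBM : measurable BM.
  by rewrite -[BM]setTI; apply: measurable_fun_ler.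
have mB i : measurable (B i).
  rewrite -[B i]setTI; apply: measurable_and => //; first exact: measurable_fun_ler.
  by apply: measurable_and; [exact: measurable_fun_ltr|exact: measurable_fun_ler].
have mU i : measurable (U i).
  rewrite -[U i]setTI; apply: measurable_fun_ler => //.
  by apply: measurableT_comp => //; exact: measurable_funB.
have bm A k : measurable A -> bounded_measurable (fun w => \1_A (xi k w) : R).
  by move=> mA; exact: bm_indic_comp.
have cover x : \sum_(i < K) \1_(B i) x = \1_BM x :> R.
  (* A cell indicator is a difference of two threshold indicators, so the sum telescopes. *)
  rewrite (eq_bigr (fun i : 'I_K => - ((`|x| <= M)%R%:R * ((lft i.+1 <= x)%R%:R - (lft i <= x)%R%:R)))); last first.
    move=> i _; rewrite indic_bool.
    have li : lft i <= lft i.+1 by rewrite /lft -[i.+1%:R]natr1; lra.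
    have [l2|l2] := leP (lft i.+1) x.
      by rewrite (le_trans li l2) /=; ring.
    by case: (lft i <= x); case: (`|x| <= M) => /=; ring.
  rewrite sumrN -mulr_sumr -(big_mkord xpredT (fun i => (lft i.+1 <= x)%R%:R - (lft i <= x)%R%:R)).
  rewrite (telescope_sumr (fun i => (lft i <= x)%R%:R)) // /BM indic_bool.
  case: (leP `|x| M) => /= [|_]; last by ring.
  rewrite ler_norml => /andP[x1 x2].
  have -> : lft 0%N <= x by rewrite /lft; lra.
  have -> : (lft K <= x) = false.
    apply/negbTE; rewrite -ltNge /lft; have := truncnS_gt (4 * M); rewrite -/K; lra.
  by rewrite /=; ring.
set pM := mean P (fun w => \1_BM (xi 0%N w)).
have hpM : 1 - q / 2 <= pM.
  have mC : measurable [set x : R | M < `|x|] by rewrite -[[set x | _]]setTI; apply: measurable_fun_ltr.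
  have : mean P (fun w => \1_[set x : R | M < `|x|] (xi 0%N w)) <= q / 2.
    rewrite mean_indic_comp // -lee_fin fineK ?fin_num_measure //.
    by rewrite -[_ @^-1` _]setTI; exact: mxi.
  move=> h; suff : 1 - mean P (fun w => \1_[set x : R | M < `|x|] (xi 0%N w)) = pM by lra.
  rewrite -{1}(mean_cst P 1) -meanB; [|exact: bm_cst|exact: bm].
  by apply: mean_eq => w; rewrite /BM !indic_bool; case: leP => _ /=; ring.
have hpU i : mean P (fun w => \1_(U i) (xi 0%N w)) <= 1 - q.
  rewrite mean_indic_comp // -lee_fin fineK ?fin_num_measure //; first exact: hU.
  by rewrite -[_ @^-1` _]setTI; exact: mxi.
(* The value comes from [pM^2 - (1 - q) pM = pM (pM - 1 + q)] and [pM >= 1 - q/2]. *)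
exists M, ((1 - q / 2) * (q / 2)); split => //; first by rewrite mulr_gt0; lra.
(* A minorant of the indicator of the event. If [|x - y| <= 1/2] and [y] lies in a cell, then [x] is
   within 1 of its left end, so the subtracted sum cancels the first term. *)
pose L w : R := \1_BM (xi 0%N w) * \1_BM (xi 1%N w) -
    \sum_(i < K) \1_(U i) (xi 0%N w) * \1_(B i) (xi 1%N w).
have bUB (i : 'I_K) : bounded_measurable (fun w => \1_(U i) (xi 0%N w) * \1_(B i) (xi 1%N w) : R).
  by apply: bmM; exact: bm.
have bL : bounded_measurable L.
  by apply: bmB; [apply: bmM; exact: bm|exact: bm_sum].
apply: (@le_trans _ _ (mean P L)); last first.
  apply: mean_le => // [|w]; first by apply: bm_indic; exact: measurable_spread_event.
  rewrite /L /spread_event /BM !indic_bool; set x := xi 0%N w; set y := xi 1%N w.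
  have [hd|hd] := ltP (1 / 2) `|x - y| => /=.
    apply: (@le_trans _ _ ((`|x| <= M)%R%:R * (`|y| <= M)%R%:R)).
      by rewrite gerBl sumr_ge0.
    have [hx|hx] := leP `|x| M; have [hy|hy] := leP `|y| M => /=; rewrite ?mulr0 ?mul0r ?mulr1 //.
    by have -> : `|x - y| <= 2 * M by apply: le_trans (ler_normB _ _) _; lra.
  rewrite subr_le0; apply: (@le_trans _ _ (\sum_(i < K) \1_(B i) y)).
    by rewrite cover /BM indic_bool; case: (`|x| <= M); rewrite ?mul1r ?mul0r.
  apply: ler_sum => i _; rewrite /B indic_bool.
  case: and3P => [[y1 y2 _]|_]; last by rewrite mulr0.
  rewrite /U indic_bool mulr1.
  suff -> : `|x - lft i| <= 1 by [].
  move: hd; rewrite !ler_norml => /andP[h1 h2]; move: y1 y2; rewrite /lft -[i.+1%:R]natr1; lra.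
rewrite meanB; [|by apply: bmM; exact: bm|exact: bm_sum].
rewrite mean_indicM // -/pM mean_sum //.
have : \sum_(i < K) mean P (fun w => \1_(U i) (xi 0%N w) * \1_(B i) (xi 1%N w)) <= (1 - q) * pM.
  rewrite /pM (mean_eq P _ (fun w => \sum_(i < K) \1_(B i) (xi 0%N w))) => [|w]; last by rewrite cover.
  rewrite mean_sum; last by move=> i; exact: bm.
  rewrite mulr_sumr; apply: ler_sum => i _; rewrite mean_indicM // ler_wpM2r //.
  by apply: Rintegral_ge0 => w _; rewrite indicE.
nra.
Qed.

(** Each factor of [|E e^{iS}|^2] is at most [exp (- E (1 - cos))]. The summed deficits are at least
    [L] on the spread event and nonnegative elsewhere, which gives [exp (- p L)]; the square root
    halves the exponent. *)
Lemma charfun_decay (M p L : R) (n : nat) (th : nat -> R) :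
  p <= mean P (\1_(spread_event M)) -> 0 <= L ->
  (forall s, 1 / 2 < `|s| -> `|s| <= 2 * M -> L <= \sum_(j < n) (1 - cos (th j * s))) ->
  mean P (fun w => cos (lincomb P xi th n w)) <= expR (- (p * L / 2)).
Proof.
move=> hp L0 hL.
have bcos (t : R) : bounded_measurable (fun w => cos (t * (xi 0%N w - xi 1%N w))).
  by apply: bm_cos; apply: measurable_funM => //; exact: measurable_funB.
have b1cos (t : R) : bounded_measurable (fun w => 1 - cos (t * (xi 0%N w - xi 1%N w))).
  by apply: bmB => //; exact: bm_cst.
set m := mean _ _.
suff h : m ^+ 2 <= expR (- (p * L / 2)) ^+ 2.
  rewrite leNgt; apply/negP => hlt; move: h; apply/negP; rewrite -ltNge.
  by rewrite ltrXn2r // expR_ge0.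
have := charfun_lincomb P xi xi_indep xi_id th n; rewrite -/m => E.
apply: (@le_trans _ _ (\prod_(j < n) expR (- mean P (fun w => 1 - cos (th j * (xi 0%N w - xi 1%N w)))))).
  apply: (@le_trans _ _ (\prod_(j < n) (ccos P xi (th j) ^+ 2 + csin P xi (th j) ^+ 2))).
    by rewrite -E lerDl sqr_ge0.
  apply: ler_prod => j _; rewrite addr_ge0 ?sqr_ge0 //=.
  rewrite charfun_sym // meanB ?mean_cst //; last exact: bm_cst.
  by apply: le_trans (expR_ge1Dx _); rewrite opprB addrC subrK.
rewrite -expR_sum sumrN -mean_sum // -expRM_natl ler_expR mulrN lerN2.
have -> : 2 * (p * L / 2) = p * L by field.
apply: (@le_trans _ _ (L * mean P (\1_(spread_event M)))).
  by rewrite mulrC ler_wpM2l.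
have bG := bm_indic _ (measurable_spread_event M).
rewrite -meanZ //.
apply: mean_le => [||w]; [exact: bmZ|exact: bm_sum|].
rewrite /spread_event indic_bool; case: andP => [[h1 h2]|_]; last first.
  by rewrite mulr0 sumr_ge0 // => j _; exact: onemcos_ge0.
by rewrite mulr1; exact: hL.
Qed.

End CharacteristicDecay.

(** * Small ball probabilities from a grid of frequencies *)

Section SmallBall.
Context {R : realType}.
Implicit Types (r : R) (N u v : nat).

(** The absolute difference: one of the two truncated subtractions vanishes. *)
Definition natdist u v : nat := (u - v + (v - u))%N.

Lemma natdist_sqr u v : (u%:R - v%:R) ^+ 2 = (natdist u v)%:R ^+ 2 :> R.
Proof.
rewrite /natdist; have [uv|uv] := leqP u v.
  by rewrite (eqP uv) add0n natrB // -sqrrN opprB.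
by rewrite [X in (_ + X)%N](eqP (ltnW uv)) addn0 natrB // ltnW.
Qed.

(** An integer is at most its square. This trades Gaussian decay for geometric decay, which is
    summed explicitly. *)
Lemma natdist_le_sqr u v : (natdist u v)%:R <= (u%:R - v%:R) ^+ 2 :> R.
Proof. by rewrite natdist_sqr -natrX ler_nat; case: natdist => // k; rewrite expnS leq_pmulr ?expn_gt0. Qed.

Lemma natdiff_sqr_le N (u v : 'I_N) : (u%:R - v%:R) ^+ 2 <= N%:R ^+ 2 :> R.
Proof.
have : (u%:R : R) <= N%:R by rewrite ler_nat ltnW.
have : (v%:R : R) <= N%:R by rewrite ler_nat ltnW.
have : (0 : R) <= u%:R by []. have : (0 : R) <= v%:R by [].
by nra.
Qed.

Lemma geometric_sum_le r N : 0 <= r < 1 -> \sum_(i < N) r ^+ i <= (1 - r)^-1.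
Proof.
move=> /andP[r0 r1]; rewrite -[leRHS]mul1r ler_pdivlMr ?subr_gt0 //.
have := subrX1 r N; set S := \sum_(i < N) _ => E.
have : 0 <= r ^+ N by exact: exprn_ge0.
by move: E; lra.
Qed.

(** A two-sided geometric series, bounded uniformly in its centre. Removing the term [v = 0] lowers
    the centre by one, hence the induction on [u]. *)
Lemma sum_exp_natdist_le r u N : 0 <= r < 1 ->
  \sum_(v < N) r ^+ natdist u v <= 2 / (1 - r).
Proof.
move=> hr; have /andP[r0 r1] := hr.
suff h : \sum_(v < N) r ^+ natdist u v <= \sum_(i < u) r ^+ i.+1 + (1 - r)^-1.
  apply: le_trans h _; have -> : 2 / (1 - r) = (1 - r)^-1 + (1 - r)^-1 by ring.
  rewrite lerD2r; apply: le_trans (geometric_sum_le r u hr).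
  by apply: ler_sum => i _; rewrite exprS ler_piMl ?exprn_ge0 // ltW.
have inv0 : 0 <= (1 - r)^-1 by rewrite invr_ge0 subr_ge0 ltW.
elim: u N => [|u IH] [|N].
- by rewrite !big_ord0 add0r.
- rewrite big_ord0 add0r; apply: le_trans (geometric_sum_le r N.+1 hr).
  by apply: ler_sum => v _; rewrite /natdist sub0n add0n subn0.
- by rewrite big_ord0 addr_ge0 // sumr_ge0 // => i _; exact: exprn_ge0.
rewrite big_ord_recl big_ord_recr /= {1}/natdist subn0 sub0n addn0.
rewrite [leLHS]addrC [leRHS]addrAC lerD //; apply: le_trans (IH N).
by apply: ler_sum => v _; rewrite /natdist /bump /= add1n !subSS.
Qed.

Lemma sum_cosB_sqr (I : finType) (phi : I -> R) :
  \sum_i \sum_j cos (phi i - phi j) = (\sum_i cos (phi i)) ^+ 2 + (\sum_i sin (phi i)) ^+ 2.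
Proof.
rewrite !expr2 !big_distrlr /= -big_split; apply: eq_bigr => i _.
by rewrite -big_split; apply: eq_bigr => j _ /=; rewrite cosB.
Qed.

Context {d : measure_display} {T : measurableType d} (P : probability T R).
Implicit Types (X Y : T -> R) (h t e : R).

(* Discrete Esseen inequality: on the event, the N^2 phases [h (u X + v Y)]
   are all at most 1 in absolute value, so their exponentials add up coherently. *)
Lemma small_ball_charfun X Y N h t : measurable_fun setT X -> measurable_fun setT Y ->
  (0 < N)%N -> 0 <= h -> 0 <= t -> 2 * h * N%:R * t <= 1 ->
  mean P (\1_[set w | X w ^+ 2 + Y w ^+ 2 <= t ^+ 2]) <=
  4 / N%:R ^+ 4 * \sum_(u < N) \sum_(v < N) \sum_(u' < N) \sum_(v' < N)
    mean P (fun w => cos (h * ((u%:R - u'%:R) * X w + (v%:R - v'%:R) * Y w))).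
Proof.
move=> mX mY N0 h0 t0 hNt.
have NR : (0 : R) < N%:R by rewrite ltr0n.
have mE : measurable [set w | X w ^+ 2 + Y w ^+ 2 <= t ^+ 2].
  rewrite -[[set w | _]]setTI; apply: measurable_fun_ler => //.
  by apply: measurable_funD; apply: measurable_funX.
have bc (a b : R) : bounded_measurable (fun w => cos (h * (a * X w + b * Y w))).
  by apply: bm_cos; apply: measurable_funM => //; apply: measurable_funD; apply: measurable_funM.
have -> : \sum_(u < N) \sum_(v < N) \sum_(u' < N) \sum_(v' < N)
    mean P (fun w => cos (h * ((u%:R - u'%:R) * X w + (v%:R - v'%:R) * Y w))) =
  mean P (fun w => \sum_(u < N) \sum_(v < N) \sum_(u' < N) \sum_(v' < N)
    cos (h * ((u%:R - u'%:R) * X w + (v%:R - v'%:R) * Y w))).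
  rewrite mean_sum => [|u]; last by do 3 (apply: bm_sum => ?).
  apply: eq_bigr => u _; rewrite mean_sum => [|v]; last by do 2 (apply: bm_sum => ?).
  apply: eq_bigr => v _; rewrite mean_sum => [|u']; last by apply: bm_sum.
  by apply: eq_bigr => u' _; rewrite mean_sum.
have bS : bounded_measurable (fun w => \sum_(u < N) \sum_(v < N) \sum_(u' < N) \sum_(v' < N)
    cos (h * ((u%:R - u'%:R) * X w + (v%:R - v'%:R) * Y w))).
  by do 4 (apply: bm_sum => ?).
rewrite -meanZ //; apply: mean_le => [||w]; [exact: bm_indic|exact: bmZ|].
(* The fourfold sum is the squared modulus of the sum of the [e^{i phi}]: nonnegative everywhere and
   at least [(N^2 / 2)^2] on the event, whence the factor [4 / N^4]. *)
pose phi (i : 'I_N * 'I_N) := h * (i.1%:R * X w + i.2%:R * Y w).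
have -> : \sum_(u < N) \sum_(v < N) \sum_(u' < N) \sum_(v' < N)
    cos (h * ((u%:R - u'%:R) * X w + (v%:R - v'%:R) * Y w)) =
    (\sum_i cos (phi i)) ^+ 2 + (\sum_i sin (phi i)) ^+ 2.
  rewrite -sum_cosB_sqr pair_big /=; apply: eq_bigr => -[u v] _ /=.
  rewrite pair_big /=; apply: eq_bigr => -[u' v'] _ /=.
  by rewrite /phi /=; congr cos; ring.
rewrite indic_bool; case: (leP (X w ^+ 2 + Y w ^+ 2) (t ^+ 2)) => [hw|_] /=; last first.
  by rewrite mulr_ge0 ?divr_ge0 ?exprn_ge0 ?addr_ge0 ?sqr_ge0.
have bX : `|X w| <= t.
  by rewrite -(@ler_pXn2r _ 2) ?nnegrE // real_normK ?num_real //; have := sqr_ge0 (Y w); lra.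
have bY : `|Y w| <= t.
  by rewrite -(@ler_pXn2r _ 2) ?nnegrE // real_normK ?num_real //; have := sqr_ge0 (X w); lra.
have cphi i : 1 / 2 <= cos (phi i).
  have p1 : `|phi i| <= 1.
    rewrite /phi normrM (ger0_norm h0); apply: le_trans hNt.
    have -> : 2 * h * N%:R * t = h * (N%:R * t + N%:R * t) by ring.
    rewrite ler_wpM2l // (le_trans (ler_normD _ _)) // lerD // normrM ger0_norm //;
      by rewrite ler_pM // ler_nat ltnW.
  have : phi i ^+ 2 <= 1 by rewrite -real_normK ?num_real // expr_le1.
  by have := onemcos_le (phi i); lra.
have hc : N%:R ^+ 2 / 2 <= \sum_i cos (phi i).
  apply: (@le_trans _ _ (\sum_(i : 'I_N * 'I_N) 1 / 2)); last exact: ler_sum.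
  by rewrite sumr_const card_prod card_ord -[(1 / 2) *+ _]mulr_natl natrM mul1r expr2.
have hc2 : (N%:R ^+ 2 / 2) ^+ 2 <= (\sum_i cos (phi i)) ^+ 2.
  have N20 : 0 <= N%:R ^+ 2 / 2 :> R by rewrite divr_ge0 ?exprn_ge0.
  by rewrite lerXn2r ?nnegrE ?(le_trans N20 hc).
have N4 : 0 < N%:R ^+ 4 :> R by rewrite exprn_gt0.
rewrite -[leLHS](@mulfV _ (N%:R ^+ 4 / 4 : R)); last by rewrite mulf_neq0 // gt_eqF.
have -> : 4 / N%:R ^+ 4 = (N%:R ^+ 4 / 4)^-1 :> R.
  by field; rewrite gt_eqF.
rewrite mulrC; apply: ler_wpM2l; first by rewrite invr_ge0 divr_ge0 // ltW.
have -> : N%:R ^+ 4 / 4 = (N%:R ^+ 2 / 2) ^+ 2 :> R by field.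
by apply: le_trans hc2 _; rewrite lerDl sqr_ge0.
Qed.

(** For each of the [N^2] pairs [(u, v)] the two geometric sums contribute a constant, so the main
    term is of order [N^-2]; the error [e] is averaged over all [N^4] terms. *)
Lemma small_ball_plane X Y N h t e r : measurable_fun setT X -> measurable_fun setT Y ->
  (0 < N)%N -> 0 <= h -> 0 <= t -> 2 * h * N%:R * t <= 1 -> 0 <= r < 1 ->
  (forall u v u' v' : 'I_N,
     mean P (fun w => cos (h * ((u%:R - u'%:R) * X w + (v%:R - v'%:R) * Y w))) <=
     r ^+ natdist u u' * r ^+ natdist v v' + e) ->
  mean P (\1_[set w | X w ^+ 2 + Y w ^+ 2 <= t ^+ 2]) <=
  4 * (2 / (1 - r)) ^+ 2 / N%:R ^+ 2 + 4 * e.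
Proof.
move=> mX mY N0 h0 t0 hNt hr hm; set K := 2 / (1 - r).
have NR : (0 : R) < N%:R by rewrite ltr0n.
have K0 : 0 <= K by case/andP: hr => _ r1; rewrite divr_ge0 // subr_ge0 ltW.
apply: le_trans (small_ball_charfun X Y N h t mX mY N0 h0 t0 hNt) _.
have -> : 4 * K ^+ 2 / N%:R ^+ 2 + 4 * e = 4 / N%:R ^+ 4 * (N%:R ^+ 2 * (K ^+ 2 + N%:R ^+ 2 * e)).
  by field; rewrite gt_eqF.
rewrite ler_wpM2l ?divr_ge0 ?exprn_ge0 //.
have -> : N%:R ^+ 2 * (K ^+ 2 + N%:R ^+ 2 * e) = \sum_(u < N) \sum_(v < N) (K ^+ 2 + N%:R ^+ 2 * e).
  by rewrite !sumr_const !card_ord -!mulrnA -[RHS]mulr_natl natrM expr2.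
apply: ler_sum => u _; apply: ler_sum => v _.
apply: (@le_trans _ _ (\sum_(u' < N) \sum_(v' < N) (r ^+ natdist u u' * r ^+ natdist v v' + e))).
  by apply: ler_sum => u' _; apply: ler_sum.
under eq_bigr do rewrite big_split /= -mulr_sumr.
rewrite big_split /= -mulr_suml; apply: lerD.
  rewrite expr2 ler_pM ?sum_exp_natdist_le //; apply: sumr_ge0 => i _; apply: exprn_ge0; by case/andP: hr.
by rewrite !sumr_const !card_ord -mulrnA -[e *+ _]mulr_natl natrM expr2.
Qed.

(** Without decay in the second coordinate the sum over [v'] costs a factor [N], and the rate drops
    to [1/N]. *)
Lemma small_ball_line X Y N h t r : measurable_fun setT X -> measurable_fun setT Y ->
  (0 < N)%N -> 0 <= h -> 0 <= t -> 2 * h * N%:R * t <= 1 -> 0 <= r < 1 ->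
  (forall u v u' v' : 'I_N,
     mean P (fun w => cos (h * ((u%:R - u'%:R) * X w + (v%:R - v'%:R) * Y w))) <=
     r ^+ natdist u u') ->
  mean P (\1_[set w | X w ^+ 2 + Y w ^+ 2 <= t ^+ 2]) <= 4 * (2 / (1 - r)) / N%:R.
Proof.
move=> mX mY N0 h0 t0 hNt hr hm; set K := 2 / (1 - r).
have NR : (0 : R) < N%:R by rewrite ltr0n.
apply: le_trans (small_ball_charfun X Y N h t mX mY N0 h0 t0 hNt) _.
have -> : 4 * K / N%:R = 4 / N%:R ^+ 4 * (N%:R ^+ 2 * (K * N%:R)).
  by field; rewrite gt_eqF.
rewrite ler_wpM2l ?divr_ge0 ?exprn_ge0 //.
have -> : N%:R ^+ 2 * (K * N%:R) = \sum_(u < N) \sum_(v < N) (K * N%:R).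
  by rewrite !sumr_const !card_ord -!mulrnA -[RHS]mulr_natl natrM expr2.
apply: ler_sum => u _; apply: ler_sum => v _.
apply: (@le_trans _ _ (\sum_(u' < N) \sum_(v' < N) r ^+ natdist u u')).
  by apply: ler_sum => u' _; apply: ler_sum.
under eq_bigr do rewrite sumr_const card_ord -mulr_natr.
by rewrite -mulr_suml ler_wpM2r // sum_exp_natdist_le.
Qed.

End SmallBall.

(** * Counting the exceptional frequencies *)

Section FrequencyCount.
Context {R : realType}.

(** These are the [k] for which [k/n] in lowest terms has denominator at most [x]. The reduced
    numerator and denominator determine [k], and each takes at most [Q] values. *)
Lemma card_large_gcd n (x : R) : (0 < n)%N -> 0 <= x ->
  (#|[pred k : 'I_n | n%:R <= (gcdn n k)%:R * x]|)%:R <= x ^+ 2.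
Proof.
move=> n0 x0; set A := [pred k : 'I_n | _]; set Q := Num.truncn x.
have Qx : Q%:R <= x by rewrite truncn_le.
have gP (k : 'I_n) : (0 < gcdn n k)%N by rewrite gcdn_gt0 n0.
have mQ k : k \in A -> (n %/ gcdn n k <= Q)%N.
  rewrite inE => h; rewrite truncn_ge_nat //.
  rewrite -(ler_pM2l (_ : 0 < (gcdn n k)%:R :> R)) ?ltr0n //.
  by rewrite -natrM mulnC divnK ?dvdn_gcdl.
have qm (k : 'I_n) : (k %/ gcdn n k < n %/ gcdn n k)%N.
  by rewrite ltn_divLR // divnK ?dvdn_gcdl.
suff h : (#|A| <= Q * Q)%N.
  apply: (@le_trans _ _ ((Q * Q)%:R)); first by rewrite ler_nat.
  by rewrite natrM -expr2 lerXn2r ?nnegrE.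
have [->//|/card_gt0P[k0 k0A]] := posnP #|A|.
have Q0 : (0 < Q)%N by apply: leq_trans (mQ k0 k0A); apply: leq_ltn_trans (qm k0).
(* The denominator is positive, so it is lowered by one to fit below [Q]; the numerator may be 0 and
   is smaller than the denominator. *)
pose f (k : 'I_n) : 'I_Q.-1.+1 * 'I_Q.-1.+1 := (inord (n %/ gcdn n k).-1, inord (k %/ gcdn n k)).
have finj : {in A &, injective f}.
  move=> k l kA lA [].
  have pos (j : 'I_n) : (0 < n %/ gcdn n j)%N by apply: leq_ltn_trans (qm j).
  have Qk j : j \in A -> ((n %/ gcdn n j).-1 < Q.-1.+1)%N.
    by move=> jA; rewrite !prednK ?mQ ?pos.
  have Qk' j : j \in A -> (j %/ gcdn n j < Q.-1.+1)%N.
    by move=> jA; rewrite prednK // (leq_trans (qm j) (mQ j jA)).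
  move=> /(congr1 val); rewrite /= !inordK ?Qk // => e1.
  move=> /(congr1 val); rewrite /= !inordK ?Qk' // => e2.
  have e1' : (n %/ gcdn n k = n %/ gcdn n l)%N by rewrite -(prednK (pos k)) e1 prednK.
  have eg : gcdn n k = gcdn n l.
    apply/eqP; rewrite -(eqn_pmul2l (pos k)) {2}e1' !divnK ?dvdn_gcdl //.
  apply: val_inj => /=.
  by rewrite -(divnK (dvdn_gcdr n k)) e2 eg divnK ?dvdn_gcdr.
rewrite -(card_in_imset finj); apply: leq_trans (max_card _) _.
by rewrite card_prod !card_ord prednK.
Qed.

(** Since [k < n], [2 k] is 0 or [n], and [k] is determined by whether it is 0. *)
Lemma card_dvd_double n : (#|[pred k : 'I_n | n %| 2 * k]| <= 2)%N.
Proof.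
set A := [pred k : 'I_n | _].
have finj : {in A &, injective (fun k : 'I_n => k == 0%N :> nat)}.
  have half (k : 'I_n) : k \in A -> k != 0%N :> nat -> (2 * k = n)%N.
    rewrite inE => /dvdnP[q hq] k0; have kn := ltn_ord k.
    have : (q < 2)%N by rewrite -(ltn_pmul2r (leq_ltn_trans (leq0n k) kn)) -hq ltn_pmul2l.
    case: q hq => [|[|//]] hq _; last by rewrite hq mul1n.
    by move: hq k0; rewrite mul0n; case: (nat_of_ord k).
  move=> k l kA lA; apply: contraPP => /eqP kl; apply/eqP.
  apply: contra kl => /eqP; have [k0|k0] := eqVneq (k : nat) 0%N.
    by move/esym/eqP => l0; apply/eqP/val_inj; rewrite /= k0 l0.
  move/esym/negbT => l0; apply/eqP/val_inj => /=.
  by apply/eqP; rewrite -(eqn_pmul2l (isT : 0 < 2)%N) half // half.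
rewrite -(card_in_imset finj); apply: leq_trans (max_card _) _.
by rewrite card_bool.
Qed.

Lemma truncn_ge_half (x : R) : 1 <= x -> x / 2 <= (Num.truncn x)%:R.
Proof.
move=> x1; have := truncnS_gt x; rewrite -natr1.
have : 1 <= (Num.truncn x)%:R :> R by rewrite ler1n truncn_gt0.
lra.
Qed.

Lemma near_powR_ge (a B : R) : 0 < a -> \forall n \near \oo, B <= n%:R `^ a.
Proof.
move=> a0; near=> n.
have h : `|B| `^ a^-1 <= n%:R by near: n; exact: nbhs_infty_ger.
apply: le_trans (ler_norm B) _.
have -> : `|B| = (`|B| `^ a^-1) `^ a by rewrite -powRrM mulVf ?gt_eqF // powRr1.
by apply: ge0_ler_powR; rewrite ?nnegrE ?powR_ge0 // ltW.
Unshelve. all: by end_near.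
Qed.

End FrequencyCount.

(** * Small ball bounds at one frequency *)

Section FrequencyBounds.
Context {R : realType} {d : measure_display} {T : measurableType d} (P : probability T R).
Context (xi : nat -> {RV P >-> R}).
Context (xi_indep : mutually_independent P (fun i => xi i : T -> R)).
Context (xi_id : identically_distributed P (fun i => xi i : T -> R)).
Context (M p : R) (p0 : 0 < p) (hp : p <= mean P (\1_(spread_event P xi M))).
Implicit Types (n N : nat) (b t : R).

Let mxi i : measurable_fun setT (xi i : T -> R) := measurable_funPT (xi i).

(** On the grid the deficit is at least [s^2 q / 8] with [s^2 >= 1/4] and [q] the squared grid
    distance, hence [q / 32]; [charfun_decay] halves it once more. *)
Definition decay_rate : R := expR (- (p / 64)).
Definition decay_sum : R := 2 / (1 - decay_rate).

Lemma decay_rate_itv : 0 <= decay_rate < 1.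
Proof. by rewrite /decay_rate expR_ge0 expR_lt1 oppr_lt0 divr_gt0. Qed.

Lemma decay_sum_ge0 : 0 <= decay_sum.
Proof. by have /andP[_ r1] := decay_rate_itv; rewrite divr_ge0 // subr_ge0 ltW. Qed.

Definition dft_event n b t : set T := [set w | dft_sq n (fun k => xi k w) b <= t ^+ 2].

Let X n b w : R := dft_re n (fun k => xi k w) b.
Let Y n b w : R := dft_im n (fun k => xi k w) b.

Lemma measurable_dft_re n b : measurable_fun setT (X n b).
Proof. by apply: measurable_sum => j; apply: measurable_funM. Qed.

Lemma measurable_dft_im n b : measurable_fun setT (Y n b).
Proof. by apply: measurable_sum => j; apply: measurable_funM. Qed.

Lemma measurable_dft_event n b t : measurable (dft_event n b t).
Proof.
rewrite -[dft_event n b t]setTI; apply: measurable_fun_ler => //.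
apply: measurable_funD; apply: measurable_funX.
  exact: measurable_dft_re.
exact: measurable_dft_im.
Qed.

Lemma mean_cos_dft_le n b (h a c L : R) : 0 <= L ->
  (forall s, 1 / 2 < `|s| -> `|s| <= 2 * M ->
     L <= \sum_(j < n) (1 - cos (wave b (h * a * s) (h * c * s) j%:R))) ->
  mean P (fun w => cos (h * (a * X n b w + c * Y n b w))) <= expR (- (p * L / 2)).
Proof.
move=> L0 hL.
have -> : mean P (fun w => cos (h * (a * X n b w + c * Y n b w))) =
    mean P (fun w => cos (lincomb P xi (fun j => wave b (h * a) (h * c) j%:R) n w)).
  apply: mean_eq => w; congr cos.
  rewrite /X /Y /dft_re /dft_im /lincomb !mulr_sumr -big_split mulr_sumr.
  by apply: eq_bigr => j _ /=; rewrite /wave; ring.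
apply: (charfun_decay P xi xi_indep xi_id M p) => // s s1 s2.
rewrite (eq_bigr (fun j : 'I_n => 1 - cos (wave b (h * a * s) (h * c * s) j%:R))); first exact: hL.
by move=> j _; rewrite /wave; congr (1 - cos _); ring.
Qed.

Lemma expR_decay_le (u v u' v' : nat) :
  expR (- (p * (((u%:R - u'%:R) ^+ 2 + (v%:R - v'%:R) ^+ 2) / 32) / 2)) <=
  decay_rate ^+ natdist u u' * decay_rate ^+ natdist v v'.
Proof.
rewrite /decay_rate -!expRM_natr -expRD ler_expR.
have := @natdist_le_sqr R u u'; have := @natdist_le_sqr R v v'.
set A := (u%:R - u'%:R) ^+ 2; set B := (v%:R - v'%:R) ^+ 2 => hB hA.
have := ler_wpM2l (ltW p0) (lerD hA hB).
by move: A B {hA hB} => A B; nra.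
Qed.

Section FixedSize.
Context (n : nat) (n0 : (0 < n)%N).
(** With mesh [n^{-1/2}] the deficit, of order [n] times the squared frequency, depends only on the
    grid coordinates. *)
Let h : R := (Num.sqrt n%:R)^-1.
Let nR : 0 < n%:R :> R. Proof. by rewrite ltr0n. Qed.
Let h0 : 0 <= h. Proof. by rewrite invr_ge0 sqrtr_ge0. Qed.
Let h2 : h ^+ 2 = n%:R^-1. Proof. by rewrite exprVn sqr_sqrtr // ltW. Qed.

Let phase_le N t : 2 * N%:R * t <= Num.sqrt n%:R -> 2 * h * N%:R * t <= 1.
Proof.
move=> H; have -> : 2 * h * N%:R * t = (2 * N%:R * t) / Num.sqrt n%:R by rewrite /h; ring.
by rewrite ler_pdivrMr ?sqrtr_gt0 // mul1r.
Qed.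

Let sqr_bounds (s : R) : 1 / 2 < `|s| -> `|s| <= 2 * M -> 1 / 4 <= s ^+ 2 <= 4 * M ^+ 2.
Proof. by move=> s1 s2; rewrite -real_normK ?num_real //; have := normr_ge0 s; nra. Qed.

Let amplitude (a c s : R) :
  (h * a * s) ^+ 2 + (h * c * s) ^+ 2 = s ^+ 2 * (a ^+ 2 + c ^+ 2) / n%:R.
Proof. by rewrite !exprMn h2; ring. Qed.

Let amplitude_le N (u v u' v' : 'I_N) (s : R) : s ^+ 2 <= 4 * M ^+ 2 ->
  s ^+ 2 * ((u%:R - u'%:R) ^+ 2 + (v%:R - v'%:R) ^+ 2) / n%:R <= 8 * M ^+ 2 * N%:R ^+ 2 / n%:R.
Proof.
move=> s2; rewrite ler_pM2r ?invr_gt0 //.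
have -> : 8 * M ^+ 2 * N%:R ^+ 2 = (4 * M ^+ 2) * (2 * N%:R ^+ 2) :> R by ring.
rewrite ler_pM ?sqr_ge0 ?addr_ge0 ?sqr_ge0 //.
by have := @natdiff_sqr_le R N u u'; have := @natdiff_sqr_le R N v v'; lra.
Qed.

(** The condition [8 M^2 N^2 <= n] keeps every amplitude on the grid at most 1, even after scaling
    by a symmetrised value of size [2 M], so the quadratic bound applies throughout. *)
Lemma small_ball_nonreal b t N : cos (n%:R * b) = 1 -> cos (2 * b) != 1 ->
  (0 < N)%N -> 0 <= t -> 2 * N%:R * t <= Num.sqrt n%:R -> 8 * M ^+ 2 * N%:R ^+ 2 <= n%:R ->
  mean P (\1_(dft_event n b t)) <= 4 * decay_sum ^+ 2 / N%:R ^+ 2.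
Proof.
move=> hb b2 N0 t0 hNt hN; rewrite -[leRHS]addr0 -(mulr0 4).
apply: (small_ball_plane P (X n b) (Y n b) N h t 0 decay_rate) => //.
- exact: measurable_dft_re.
- exact: measurable_dft_im.
- exact: phase_le.
- exact: decay_rate_itv.
move=> u v u' v'; rewrite addr0; apply: le_trans (expR_decay_le u v u' v').
apply: mean_cos_dft_le => [|s s1 s2]; first by rewrite divr_ge0 ?addr_ge0 ?sqr_ge0.
have /andP[sl su] := sqr_bounds _ s1 s2.
apply: le_trans (sum_onemcos_wave_small _ _ _ _ hb b2 _); rewrite amplitude; last first.
  apply: le_trans (amplitude_le _ _ _ _ _ _ su) _.
  by rewrite ler_pdivrMr // mul1r.
set q := _ + _; have q0 : 0 <= q by rewrite addr_ge0 ?sqr_ge0.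
have -> : n%:R * (s ^+ 2 * q / n%:R) / 8 = s ^+ 2 * q / 8 by field; rewrite gt_eqF.
by nra.
Qed.

Lemma small_ball_real b t N : cos (2 * b) = 1 ->
  (0 < N)%N -> 0 <= t -> 2 * N%:R * t <= Num.sqrt n%:R -> 8 * M ^+ 2 * N%:R ^+ 2 <= n%:R ->
  mean P (\1_(dft_event n b t)) <= 4 * decay_sum / N%:R.
Proof.
move=> b2 N0 t0 hNt hN.
apply: (small_ball_line P (X n b) (Y n b) N h t decay_rate) => //.
- exact: measurable_dft_re.
- exact: measurable_dft_im.
- exact: phase_le.
- exact: decay_rate_itv.
(* The decay bound is taken with equal second coordinates, as only the first coordinate decays
   here. *)
move=> u v u' v'; apply: le_trans (le_trans (expR_decay_le u v u' v) _); last first.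
  by rewrite {2}/natdist subnn addn0 expr0 mulr1.
apply: mean_cos_dft_le => [|s s1 s2]; first by rewrite divr_ge0 ?addr_ge0 ?sqr_ge0.
have /andP[sl su] := sqr_bounds _ s1 s2.
set a := u%:R - u'%:R; have aE : (h * a * s) ^+ 2 = s ^+ 2 * a ^+ 2 / n%:R.
  by rewrite !exprMn h2; ring.
apply: le_trans (sum_onemcos_wave_real _ _ _ _ b2 _); rewrite aE; last first.
  apply: (@le_trans _ _ (8 * M ^+ 2 * N%:R ^+ 2 / n%:R)).
    apply: le_trans (amplitude_le _ u v u' v' _ su); rewrite -/a.
    by rewrite ler_pM2r ?invr_gt0 // ler_wpM2l ?sqr_ge0 // lerDl sqr_ge0.
  by rewrite ler_pdivrMr // mul1r.
have -> : n%:R * (s ^+ 2 * a ^+ 2 / n%:R) / 4 = s ^+ 2 * a ^+ 2 / 4 by field; rewrite gt_eqF.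
have a0 := sqr_ge0 a.
by rewrite subrr expr0n addr0; nra.
Qed.

(** Amplitudes up to 1 are treated quadratically. For larger ones a deficit of [n / 128] is
    available, because the step [j0] has a chord short enough for the largest amplitude on the grid;
    this produces the exponential error. *)
Lemma small_ball_generic b t N (j0 : nat) : cos (n%:R * b) = 1 -> cos (2 * b) != 1 ->
  (0 < N)%N -> 0 <= t -> 2 * N%:R * t <= Num.sqrt n%:R ->
  cos (j0%:R * b) != 1 ->
  8 * M ^+ 2 * N%:R ^+ 2 / n%:R * (2 - 2 * cos (j0%:R * b)) <= 1 / 4 ->
  mean P (\1_(dft_event n b t)) <=
  4 * decay_sum ^+ 2 / N%:R ^+ 2 + 4 * expR (- (p * (n%:R / 128) / 2)).
Proof.
move=> hb b2 N0 t0 hNt j01 hN.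
apply: (small_ball_plane P (X n b) (Y n b) N h t _ decay_rate) => //.
- exact: measurable_dft_re.
- exact: measurable_dft_im.
- exact: phase_le.
- exact: decay_rate_itv.
move=> u v u' v'.
have := expR_decay_le u v u' v'.
set a := u%:R - u'%:R; set c := v%:R - v'%:R; set q := a ^+ 2 + c ^+ 2 => dec.
have q0 : 0 <= q by rewrite addr_ge0 ?sqr_ge0.
have c0 := cos_le1 (j0%:R * b).
(* The regime depends on the symmetrised value [s], whereas the decay lemma requires one lower bound
   for all [s]: hence the minimum. *)
apply: (@le_trans _ _ (expR (- (p * Num.min (q / 32) (n%:R / 128) / 2)))); last first.
  have e0 (x : R) := expR_ge0 x.
  case: (leP (q / 32) (n%:R / 128)) => _; first by apply: le_trans dec _; rewrite lerDl.
  rewrite lerDr mulr_ge0 // exprn_ge0 //; by have /andP[] := decay_rate_itv.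
apply: mean_cos_dft_le => [|s s1 s2]; first by rewrite le_min !divr_ge0.
have /andP[sl su] := sqr_bounds _ s1 s2.
have ampl := amplitude_le _ u v u' v' _ su; rewrite -/a -/c -/q in ampl.
rewrite ge_min; apply/orP.
have [small|large] := leP (s ^+ 2 * q / n%:R) 1.
  left; apply: le_trans (sum_onemcos_wave_small _ _ _ _ hb b2 _); rewrite amplitude -/q //.
  have -> : n%:R * (s ^+ 2 * q / n%:R) / 8 = s ^+ 2 * q / 8 by field; rewrite gt_eqF.
  by nra.
right; apply: (sum_onemcos_wave_large _ _ _ _ j0) => //; rewrite amplitude -/q; first exact: ltW.
apply: le_trans hN; apply: ler_wpM2r => //; lra.
Qed.

End FixedSize.
End FrequencyBounds.

(** * Union bound over the frequencies *)

Section SigmaMinTail.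
Context {R : realType} {d : measure_display} {T : measurableType d} (P : probability T R).
Context (xi : nat -> {RV P >-> R}).
Context (xi_indep : mutually_independent P (fun i => xi i : T -> R)).
Context (xi_id : identically_distributed P (fun i => xi i : T -> R)).
Context (M p : R) (M0 : 0 < M) (p0 : 0 < p) (hp : p <= mean P (\1_(spread_event P xi M))).

Context (K c0 : R) (KE : K = decay_sum p) (c0E : c0 = 2 + 3 * M).

Let K0 : 0 <= K. Proof. by rewrite KE; exact: decay_sum_ge0. Qed.
Let c00 : 0 < c0. Proof. by rewrite c0E addr_gt0 ?mulr_gt0. Qed.

(** The indicators mark the exceptional frequencies: those with reduced denominator at most
    [n^{1/4}], and those where the transform is real. They use a grid of bounded radius, the generic
    ones a grid of radius about [1/t]. *)
Lemma frequency_bound n (k : 'I_n) (t : R) : 0 < t <= 1 ->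
  c0 <= Num.sqrt n%:R -> 2 * (16 * M) ^+ 2 <= t ^+ 2 * Num.sqrt n%:R ->
  mean P (\1_(dft_event P xi n (rootangle n k) t)) <=
    64 * K ^+ 2 * t ^+ 2 / n%:R + 4 * expR (- (p * (n%:R / 128) / 2)) +
    (n%:R <= (gcdn n k)%:R * Num.sqrt (Num.sqrt n%:R) :> R)%R%:R * (16 * K ^+ 2 * c0 ^+ 2 / n%:R) +
    (n %| 2 * k)%:R * (8 * K * c0 / Num.sqrt n%:R).
Proof.
move=> /andP[t0 t1]; set sn : R := Num.sqrt n%:R => hc hM.
have n0 : (0 < n)%N by case: n k {sn hc hM} => [[]|].
have nR : 0 < n%:R :> R by rewrite ltr0n.
have t0' := ltW t0; have c00' := ltW c00.
have sn0 : 0 < sn by rewrite sqrtr_gt0.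
have sn2 : sn ^+ 2 = n%:R by rewrite sqr_sqrtr // ltW.
set b := rootangle n k; set bad := (_ <= _ * _); set ev := expR _.
have hb : cos (n%:R * b) = 1 by exact: rootangle_full.
have T1 : 0 <= 64 * K ^+ 2 * t ^+ 2 / n%:R by rewrite divr_ge0 ?mulr_ge0 ?sqr_ge0.
have T2 : 0 <= 4 * ev by rewrite mulr_ge0 ?expR_ge0.
have T3 : 0 <= 16 * K ^+ 2 * c0 ^+ 2 / n%:R by rewrite divr_ge0 ?mulr_ge0 ?sqr_ge0.
have T4 : 0 <= 8 * K * c0 / sn by rewrite divr_ge0 ?mulr_ge0 // ltW.
have T3' : 0 <= bad%:R * (16 * K ^+ 2 * c0 ^+ 2 / n%:R) by rewrite mulr_ge0.
have T4' : 0 <= (n %| 2 * k)%:R * (8 * K * c0 / sn) by rewrite mulr_ge0.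
(* With [c0 = 2 + 3 M], [N0 c0 <= sqrt n] yields both [2 N0 t <= sqrt n] for [t <= 1] and, since
   [8 <= 3^2], [8 M^2 N0^2 <= n]. *)
set N0 := Num.truncn (sn / c0).
have N0l : sn / (2 * c0) <= N0%:R.
  rewrite invfM [2^-1 * _]mulrC mulrA; apply: truncn_ge_half.
  by rewrite ler_pdivlMr // mul1r.
have N0u : N0%:R * c0 <= sn.
  by rewrite -ler_pdivlMr // truncn_le divr_ge0 // ltW.
have N0R : 0 < N0%:R :> R by apply: lt_le_trans N0l; rewrite divr_gt0 ?mulr_gt0.
have N0p : (0 < N0)%N by rewrite -(ltr0n R).
have N0M : 0 < N0%:R * M by rewrite mulr_gt0.
have N0a : 2 * N0%:R * t <= sn.
  have : N0%:R * t <= N0%:R by rewrite ler_piMr // ltW.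
  by move: N0u N0M; rewrite c0E; nra.
have N0b : 8 * M ^+ 2 * N0%:R ^+ 2 <= n%:R.
  have h3 : 3 * M * N0%:R <= sn by move: N0u N0R; rewrite c0E; nra.
  have : (3 * M * N0%:R) ^+ 2 <= sn ^+ 2 by rewrite lerXn2r ?nnegrE ?mulr_ge0 // ltW.
  by rewrite sn2; have := sqr_ge0 (M * N0%:R); nra.
have N0v : N0%:R^-1 <= 2 * c0 / sn.
  by rewrite -[leRHS]invrK lef_pV2 ?posrE ?invr_gt0 ?divr_gt0 ?mulr_gt0 // invf_div.
have [nk|nk] := boolP (n %| 2 * k)%N.
  have b2 : cos (2 * b) = 1.
    rewrite rootangleM; case/dvdnP: nk => q ->.
    rewrite /rootangle natrM mulrA mulfK ?gt_eqF //; exact: cos_2piM.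
  apply: le_trans (small_ball_real P xi xi_indep xi_id M p p0 hp n n0 b t N0 b2 N0p (ltW t0) N0a N0b) _; rewrite -KE.
  apply: (@le_trans _ _ (8 * K * c0 / sn)); last by rewrite mul1r; lra.
  have -> : 8 * K * c0 / sn = 4 * K * (2 * c0 / sn) by ring.
  by rewrite ler_wpM2l ?mulr_ge0.
have b2 : cos (2 * b) != 1.
  by rewrite rootangleM cos_rootangle_neq1.
rewrite mul0r addr0.
have [hbad|hgood] := leP n%:R ((gcdn n k)%:R * Num.sqrt sn).
  apply: le_trans (small_ball_nonreal P xi xi_indep xi_id M p p0 hp n n0 b t N0 hb b2 N0p (ltW t0) N0a N0b) _; rewrite -KE.
  apply: (@le_trans _ _ (16 * K ^+ 2 * c0 ^+ 2 / n%:R)); last first.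
    by rewrite /bad hbad mul1r; lra.
  have -> : 16 * K ^+ 2 * c0 ^+ 2 / n%:R = 4 * K ^+ 2 * (2 * c0 / sn) ^+ 2.
    by rewrite -sn2; field; rewrite gt_eqF.
  rewrite ler_wpM2l ?mulr_ge0 ?sqr_ge0 // -exprVn lerXn2r ?nnegrE ?invr_ge0 //.
  by rewrite divr_ge0 ?mulr_ge0 // ltW.
(* The largest grid compatible with [2 N t <= sqrt n]. *)
set N := Num.truncn (sn / (2 * t)).
have snt : 2 * t <= sn by move: hc M0; rewrite c0E; lra.
have Nl : sn / (4 * t) <= N%:R.
  have -> : sn / (4 * t) = sn / (2 * t) / 2 by field; rewrite gt_eqF.
  by apply: truncn_ge_half; rewrite ler_pdivlMr ?mulr_gt0 // mul1r.
have Nu : N%:R * (2 * t) <= sn.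
  by rewrite -ler_pdivlMr ?mulr_gt0 // truncn_le divr_ge0 // ?mulr_ge0 // ltW.
have NR : 0 < N%:R :> R by apply: lt_le_trans Nl; rewrite divr_gt0 ?mulr_gt0.
have Np : (0 < N)%N by rewrite -(ltr0n R).
have Na : 2 * N%:R * t <= sn by move: Nu; nra.
have Nv : N%:R^-1 <= 4 * t / sn.
  by rewrite -[leRHS]invrK lef_pV2 ?posrE ?invr_gt0 ?divr_gt0 ?mulr_gt0 // invf_div.
have [j0 hj0] := @exists_rootangle_gcd R n k n0.
have j01 : cos (j0%:R * b) != 1.
  rewrite hj0 cos_rootangle_neq1 //; apply: contra nk => /dvdn_trans -> //.
  by rewrite (dvdn_trans (dvdn_gcdr n k)) ?dvdn_mull.
(* For a good frequency [gcd(n, k) / n < n^{-1/4}], and the chord is at most 8 times this ratio. *)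
have chord : 2 - 2 * cos (j0%:R * b) <= 64 / sn.
  rewrite hj0; apply: le_trans (chord_rootangle_le n _) _.
  have gx : (gcdn n k)%:R / n%:R <= (Num.sqrt sn)^-1.
    by rewrite ler_pdivrMr // mulrC ler_pdivlMr ?sqrtr_gt0 // ltW.
  have -> : 64 / sn = (8 * (Num.sqrt sn)^-1) ^+ 2.
    by rewrite exprMn exprVn sqr_sqrtr ?ltW //; ring.
  have -> : 8 * (gcdn n k)%:R / n%:R = 8 * ((gcdn n k)%:R / n%:R) :> R by ring.
  by rewrite lerXn2r ?nnegrE ?mulr_ge0 ?divr_ge0 ?invr_ge0 ?sqrtr_ge0 ?ler_wpM2l.
(* The grid has [N^2 / n <= 1 / (4 t^2)], so the product is at most [128 M^2 / (t^2 sqrt n)]; the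
   hypothesis on [t^2 sqrt n] brings it down to [1/4]. *)
have hN : 8 * M ^+ 2 * N%:R ^+ 2 / n%:R * (2 - 2 * cos (j0%:R * b)) <= 1 / 4.
  have Nn : N%:R ^+ 2 / n%:R <= (4 * t ^+ 2)^-1.
    rewrite ler_pdivrMr // mulrC ler_pdivlMr ?mulr_gt0 ?exprn_gt0 // -sn2.
    have -> : N%:R ^+ 2 * (4 * t ^+ 2) = (N%:R * (2 * t)) ^+ 2 by ring.
    by rewrite lerXn2r ?nnegrE ?mulr_ge0 // ltW.
  have cg : 0 <= 2 - 2 * cos (j0%:R * b) by have := cos_le1 (j0%:R * b); lra.
  apply: (@le_trans _ _ (8 * M ^+ 2 * (4 * t ^+ 2)^-1 * (64 / sn))).
    have M8 : 0 <= 8 * M ^+ 2 by rewrite mulr_ge0 ?sqr_ge0.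
    rewrite -[8 * M ^+ 2 * N%:R ^+ 2 / n%:R]mulrA; apply: ler_pM => //.
      by apply: mulr_ge0 => //; rewrite divr_ge0 ?sqr_ge0.
    exact: ler_wpM2l.
  have -> : 8 * M ^+ 2 * (4 * t ^+ 2)^-1 * (64 / sn) = (2 * (16 * M) ^+ 2) / (t ^+ 2 * sn) / 4.
    by field; rewrite !gt_eqF.
  by rewrite ler_wpM2r // ler_pdivrMr ?mul1r // mulr_gt0 ?exprn_gt0.
apply: le_trans (small_ball_generic P xi xi_indep xi_id M p p0 hp n n0 b t N j0 hb b2 Np (ltW t0) Na j01 hN) _.
rewrite -KE -/ev -[leLHS]addr0; apply: lerD => //; rewrite lerD2r.
have -> : 64 * K ^+ 2 * t ^+ 2 / n%:R = 4 * K ^+ 2 * (4 * t / sn) ^+ 2.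
  by rewrite -sn2; field; rewrite gt_eqF.
rewrite ler_wpM2l ?mulr_ge0 ?sqr_ge0 // -exprVn lerXn2r ?nnegrE ?invr_ge0 //.
by rewrite divr_ge0 ?mulr_ge0 // ltW.
Qed.

(** From [exp y >= y^2 / 2] the left side is of order [1/n], then relaxed to [n^{-1/2}]. *)
Lemma expR_tail_le n : (0 < n)%N ->
  n%:R * (4 * expR (- (p * (n%:R / 128) / 2))) <= 8 * 256 ^+ 2 / p ^+ 2 / Num.sqrt n%:R.
Proof.
move=> n0; have nR : 0 < n%:R :> R by rewrite ltr0n.
set y := p * (n%:R / 128) / 2.
have y0 : 0 < y by rewrite /y !mulr_gt0 ?invr_gt0.
have e2 : y ^+ 2 / 2 <= expR y.
  by apply: le_trans (expR_ge1Dxn 1 (ltW y0)); rewrite lerDr.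
have : expR (- y) <= 2 / y ^+ 2.
  rewrite expRN -[leRHS]invrK lef_pV2 ?posrE ?expR_gt0 ?invr_gt0 ?divr_gt0 ?exprn_gt0 //.
  by rewrite invf_div.
move=> h; apply: (@le_trans _ _ (n%:R * (4 * (2 / y ^+ 2)))).
  by rewrite !ler_wpM2l // ltW.
have -> : n%:R * (4 * (2 / y ^+ 2)) = 8 * 256 ^+ 2 / p ^+ 2 / n%:R.
  by rewrite /y; field; rewrite !gt_eqF.
rewrite ler_wpM2l ?divr_ge0 ?sqr_ge0 // lef_pV2 ?posrE ?sqrtr_gt0 //.
have s1 : 1 <= Num.sqrt n%:R :> R by rewrite -[leLHS]sqrtr1 ler_sqrt // ler1n.
by rewrite -[leRHS](sqr_sqrtr (ltW nR)) expr2 ler_peMl // sqrtr_ge0.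
Qed.

(** Summed over [k], the generic term gives [t^2]; at most [sqrt n] frequencies of small denominator
    cost [1/n] each, and at most two real ones [n^{-1/2}] each. *)
Lemma sigma_min_tail n (t : R) : 0 < t <= 1 ->
  c0 <= Num.sqrt n%:R -> 2 * (16 * M) ^+ 2 <= t ^+ 2 * Num.sqrt n%:R ->
  (P [set w | (sigma_min (circulant n (fun k => xi k w)) <= t)%R] <=
   (64 * K ^+ 2 * t ^+ 2 +
     (8 * 256 ^+ 2 / p ^+ 2 + 16 * K ^+ 2 * c0 ^+ 2 + 16 * K * c0) / Num.sqrt n%:R)%:E)%E.
Proof.
move=> ht hc hM; have /andP[t0 t1] := ht.
have sn0 : 0 < Num.sqrt n%:R :> R by exact: lt_le_trans hc.
have nR : 0 < n%:R :> R by rewrite -sqrtr_gt0.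
have n0 : (0 < n)%N by rewrite -(ltr0n R).
have sn2 : Num.sqrt n%:R ^+ 2 = n%:R :> R by rewrite sqr_sqrtr // ltW.
pose E (k : nat) := dft_event P xi n (rootangle n k) t.
have mE k : measurable (E k) by exact: measurable_dft_event.
have -> : [set w | sigma_min (circulant n (fun k => xi k w)) <= t] = \big[setU/set0]_(k < n) E k.
  apply/seteqP; split => w /=.
    move/(sigma_min_circulant_le n (fun k => xi k w) t n0 (ltW t0)) => [k hk].
    by rewrite -bigcup_mkord; exists k => //=.
  rewrite -bigcup_mkord => -[k /= kn hk].
  apply/(sigma_min_circulant_le n (fun k => xi k w) t n0 (ltW t0)).
  by exists (Ordinal kn).
apply: le_trans (Boole_inequality P (fun k _ => mE k)) _.
rewrite (eq_bigr (fun k : 'I_n => (mean P (\1_(E k)))%:E)) => [|k _]; last exact: prob_mean.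
rewrite sumEFin lee_fin.
apply: le_trans (ler_sum _ (fun k _ => frequency_bound n k t ht hc hM)) _.
rewrite !big_split /=.
set x : R := Num.sqrt (Num.sqrt n%:R).
have x2 : x ^+ 2 = Num.sqrt n%:R by rewrite sqr_sqrtr // sqrtr_ge0.
have cb : (\sum_(i < n) (n%:R <= (gcdn n i)%:R * x)%R)%:R <= Num.sqrt n%:R :> R.
  rewrite -x2; apply: le_trans (@card_large_gcd R n x n0 (sqrtr_ge0 _)).
  by rewrite ler_nat -sum1_card [leqRHS]big_mkcond leq_sum // => i _; rewrite inE; case: (_ <= _).
have cr : (\sum_(i < n) (n %| 2 * i))%:R <= 2 :> R.
  rewrite ler_nat; apply: leq_trans (card_dvd_double n).
  by rewrite -sum1_card [leqRHS]big_mkcond leq_sum // => i _; rewrite inE; case: (_ %| _).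
have he := expR_tail_le n n0.
have -> : 64 * K ^+ 2 * t ^+ 2 + (8 * 256 ^+ 2 / p ^+ 2 + 16 * K ^+ 2 * c0 ^+ 2 + 16 * K * c0) / Num.sqrt n%:R
  = 64 * K ^+ 2 * t ^+ 2 + 8 * 256 ^+ 2 / p ^+ 2 / Num.sqrt n%:R
   + 16 * K ^+ 2 * c0 ^+ 2 / Num.sqrt n%:R + 2 * (8 * K * c0 / Num.sqrt n%:R) by ring.
apply: lerD; first (apply: lerD; first apply: lerD).
- by rewrite sumr_const card_ord -[leLHS]mulr_natl mulrC divfK // gt_eqF.
- by rewrite sumr_const card_ord -[leLHS]mulr_natl.
- rewrite -mulr_suml -natr_sum.
  have -> : 16 * K ^+ 2 * c0 ^+ 2 / Num.sqrt n%:R = Num.sqrt n%:R * (16 * K ^+ 2 * c0 ^+ 2 / n%:R).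
    by rewrite -{3}sn2; field; rewrite gt_eqF.
  by rewrite ler_wpM2r // divr_ge0 // ?mulr_ge0 ?sqr_ge0 // ltW.
- rewrite -mulr_suml -natr_sum.
  by rewrite ler_wpM2r // divr_ge0 ?mulr_ge0 // ltW.
Qed.

End SigmaMinTail.

Lemma ler_weighted_sum (R : realFieldType) (C1 C2 x y z : R) :
  0 <= C1 -> 0 <= C2 -> 0 <= x -> 0 <= y -> 0 <= z ->
  C1 * x + C2 * z <= (C1 + C2) * (x + y + z).
Proof.
move=> C10 C20 x0 y0 z0.
have := mulr_ge0 C10 y0; have := mulr_ge0 C10 z0.
have := mulr_ge0 C20 x0; have := mulr_ge0 C20 y0.
by nra.
Qed.

Theorem mainTheorem4 (R : realType) (d : measure_display)
  (T : measurableType d) (P : probability T R) (xi : nat -> {RV P >-> R}) :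
  mutually_independent P (fun i => xi i : T -> R) ->
  identically_distributed P (fun i => xi i : T -> R) ->
  condH P (xi 0%N) ->
  exists C : R, 0 < C /\
    forall eps rho : R, 0 < eps -> 0 < rho < 1 / 4 ->
      exists delta : nat -> R, delta @ \oo --> 0 /\
        \forall n \near \oo,
          (P [set w | (sigma_min (circulant n (fun k => xi k w))
                        <= eps * (n%:R `^ (- rho)))%R]
           <= (C * ((eps ^+ 2 + eps) / n%:R `^ (2 * rho)
                    + n%:R `^ (- (1 / 2) + delta n)))%:E)%E.
Proof.
move=> indep ident /(spread_event_gt0 P xi indep ident)[M [p [M0 p0 hp]]].
have [K KE] : exists K, K = decay_sum p by exists (decay_sum p).
have [c0 c0E] : exists c0, c0 = 2 + 3 * M by exists (2 + 3 * M).
have K0 : 0 <= K by rewrite KE; exact: decay_sum_ge0.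
have c00 : 0 < c0 by rewrite c0E addr_gt0 ?mulr_gt0.
set C1 := 64 * K ^+ 2.
set C2 := 8 * 256 ^+ 2 / p ^+ 2 + 16 * K ^+ 2 * c0 ^+ 2 + 16 * K * c0.
have C10 : 0 <= C1 by rewrite mulr_ge0 ?sqr_ge0.
have C20 : 0 < C2.
  rewrite /C2 -addrA ltr_pwDl ?divr_gt0 ?exprn_gt0 //.
  by rewrite addr_ge0 ?mulr_ge0 ?sqr_ge0 // ltW.
exists (C1 + C2); split; first by lra.
move=> eps rho eps0 /andP[rho0 rho1].
exists (fun=> 0); split; first exact: cvg_cst.
near=> n.
have n1 : (0 < n)%N by near: n; exact: nbhs_infty_gt.
have nR : 0 < n%:R :> R by rewrite ltr0n.
have sqE : Num.sqrt n%:R = n%:R `^ (1 / 2) :> R by rewrite mul1r powR12_sqrt // ltW.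
set t := eps * n%:R `^ (- rho).
have t2 : t ^+ 2 = eps ^+ 2 / n%:R `^ (2 * rho).
  rewrite /t exprMn powRN exprVn; congr (_ / _).
  by rewrite -powR_mulrn ?powR_ge0 // -powRrM mulrC.
have t0 : 0 < t by rewrite mulr_gt0 ?powR_gt0.
(* As [rho > 0], [n^rho] eventually exceeds [eps]. *)
have t1 : t <= 1.
  rewrite /t powRN ler_pdivrMr ?powR_gt0 // mul1r.
  by near: n; exact: near_powR_ge.
have hc : c0 <= Num.sqrt n%:R.
  by rewrite sqE; near: n; apply: near_powR_ge.
(* This is where [rho < 1/4] enters: [t^2 sqrt n = eps^2 n^{1/2 - 2 rho}] has a positive exponent
   and tends to infinity. *)
have hM : 2 * (16 * M) ^+ 2 <= t ^+ 2 * Num.sqrt n%:R.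
  have -> : t ^+ 2 * Num.sqrt n%:R = eps ^+ 2 * n%:R `^ (1 / 2 - 2 * rho).
    have hn : (1 / 2 == 2 * rho) ==> (n%:R != 0 :> R) by rewrite (gt_eqF nR) implybT.
    by rewrite t2 sqE (powRB hn) mulrAC -mulrA.
  rewrite mulrC -ler_pdivrMl ?exprn_gt0 //.
  by near: n; apply: near_powR_ge; lra.
apply: le_trans (sigma_min_tail P xi indep ident M p M0 p0 hp K c0 KE c0E n t _ hc hM) _; first by rewrite t0 t1.
rewrite lee_fin -/C1 -/C2 t2 addr0.
have -> : n%:R `^ (- (1 / 2)) = (Num.sqrt n%:R)^-1 :> R by rewrite powRN sqE.
have a0 : 0 < (n%:R `^ (2 * rho))^-1 :> R by rewrite invr_gt0 powR_gt0.
have s0 : 0 < (Num.sqrt n%:R)^-1 :> R by rewrite invr_gt0 sqrtr_gt0.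
move: a0 s0; set a := (_ `^ _)^-1; set s := (Num.sqrt _)^-1 => a0 s0.
rewrite [(_ + eps) / _]mulrDl.
have A0 : 0 <= eps ^+ 2 * a by rewrite mulr_ge0 ?sqr_ge0 // ltW.
have B0 : 0 <= eps * a by rewrite mulr_ge0 // ltW.
exact: (ler_weighted_sum _ _ _ _ _ _ C10 (ltW C20) A0 B0 (ltW s0)).
Unshelve. all: by end_near.
Qed.
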